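(* Suppose that: each gradient $\nabla f(\cdot,i)$, $i\in[n]$, is Lipschitz continuous on $\mathrm{dom}(\varphi)$ with modulus $\mathsf{L}>0$; $\varphi$ is $\rho$-weakly convex ($\rho>0$), lower semicontinuous and proper; and there are $f_{\mathrm{lb}},\varphi_{\mathrm{lb}}\in\mathbb{R}$ with $f(w,i)\ge f_{\mathrm{lb}}$ and $\varphi(w)\ge\varphi_{\mathrm{lb}}$ for all $w\in\mathrm{dom}(\varphi)$, $i\in[n]$. Let $\{w^k\}_k$ be generated by norm-PRR (with an arbitrary sequence of permutations) with $\lambda\in(0,\frac1{4\rho})$ and step sizes $$\alpha_k=\frac{\alpha}{(\beta+k)^\gamma},\qquad\alpha>0,\ \beta\ge0,\ \gamma\in(\tfrac12,1].$$ Assume that $\{w^k\}_k$ is bounded and that $\psi$ has the Kurdyka-{\L}ojasiewicz (KL) property at every accumulation point of $\{w^k\}_k$. Then $\{w^k\}_k$ converges to some $w^*$ with $0\in\partial\psi(w^* )$. Let $\theta\in[0,1)$ and $c>0$ be the KL exponent and a corresponding KL constant of $\psi$ at $w^*$, and let $\tilde c:=c+\max\{1,\frac{\tau\lambda}{2}\}$. Then, for all $k$ sufficiently large: If $\gamma\in(\frac12,1)$, $$\max\{\mathrm{dist}(0,\partial\psi(w^k))^2,|\psi(w^k)-\psi(w^* )|\}=\begin{cases}\mathcal{O}(k^{-(3\gamma-1)})&\text{if }0\le\theta<\frac{\gamma}{3\gamma-1},\\ \mathcal{O}(k^{-\frac{1-\gamma}{2\theta-1}})&\text{if }\frac{\gamma}{3\gamma-1}\le\theta<1,\end{cases}$$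 and $$\|w^k-w^*\|=\begin{cases}\mathcal{O}(k^{-(2\gamma-1)})&\text{if }0\le\theta<\frac{\gamma}{3\gamma-1},\\ \mathcal{O}(k^{-\frac{(1-\theta)(1-\gamma)}{2\theta-1}})&\text{if }\frac{\gamma}{3\gamma-1}\le\theta<1.\end{cases}$$ Moreover, if $\theta\in[0,\frac12]$, $\gamma=1$ and $\alpha>16\tilde c^2/(\tau n)$, then $$\max\{\mathrm{dist}(0,\partial\psi(w^k))^2,|\psi(w^k)-\psi(w^* )|\}=\mathcal{O}(k^{-2})\quad\text{and}\quad\|w^k-w^*\|=\mathcal{O}(k^{-1}).$$
   Context: Setting: $d,n\in\mathbb{N}$, $[n]=\{1,\dots,n\}$; $f(\cdot,i):\mathbb{R}^d\to\mathbb{R}$ are differentiable; $f(w)=\frac1n\sum_{i=1}^n f(w,i)$; $\varphi:\mathbb{R}^d\to(-\infty,\infty]$; $\psi=f+\varphi$. $\|\cdot\|$ is the Euclidean norm. $\varphi$ is $\rho$-weakly convex if $\varphi+\frac{\rho}{2}\|\cdot\|^2$ is convex. $\partial$ denotes the Fr\'echet (regular) subdifferential, $\partial h(x)=\{g: h(y)\ge h(x)+\langle g,y-x\rangle+o(\|y-x\|)\text{ as }y\to x\}$; here $\partial\psi=\nabla f+\partial\varphi$. $\mathrm{dist}(0,\emptyset)=+\infty$. KL property: $\psi$ has the KL property at $\bar w\in\mathrm{dom}(\psi)$ with exponent $\theta\in[0,1)$ and constant $c>0$ if there exist $\eta\in(0,\infty]$ and a neighborhood $U$ of $\bar w$ such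 that $|\psi(w)-\psi(\bar w)|^\theta\le c\cdot\mathrm{dist}(0,\partial\psi(w))$ for all $w\in U$ with $0<|\psi(w)-\psi(\bar w)|<\eta$; it has the KL property at $\bar w$ if this holds for some such $\theta,c$. For $\lambda\in(0,\rho^{-1})$: $\mathrm{prox}_{\lambda\varphi}(w)=\mathrm{argmin}_y\,\varphi(y)+\frac1{2\lambda}\|w-y\|^2$. Algorithm norm-PRR: given an initial point $z^1\in\mathbb{R}^d$, $w^1=\mathrm{prox}_{\lambda\varphi}(z^1)$, step sizes $\alpha_k>0$ and $\lambda>0$; for $k=1,2,\dots$: choose a permutation $\pi^k=(\pi^k_1,\dots,\pi^k_n)$ of $[n]$; set $z^k_1=z^k$, $w^k_1=w^k$; for $i=1,\dots,n$ set $z^k_{i+1}=z^k_i-\alpha_k(\nabla f(w^k_i,\pi^k_i)+\frac1\lambda(z^k_i-w^k_i))$ and $w^k_{i+1}=\mathrm{prox}_{\lambda\varphi}(z^k_{i+1})$; set $z^{k+1}=z^k_{n+1}$, $w^{k+1}=w^k_{n+1}$. Constant: $\tau=\frac{1-4\lambda\rho}{2(1-2\lambda\rho+\lambda^2\mathsf{L}^2)}$. *)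

(* Defs.v *)
From HB Require Import structures.
From mathcomp Require Export all_boot all_order all_fingroup all_algebra.
From mathcomp Require Export all_classical all_reals all_analysis.

Set Implicit Arguments.
Unset Strict Implicit.
Unset Printing Implicit Defensive.

Export Order.TTheory GRing.Theory Num.Theory numFieldNormedType.Exports.

Local Open Scope classical_set_scope.
Local Open Scope ring_scope.

(* The norm `|_| on 'rV[R]_d is the sup norm (with the same topology), so the
   Euclidean structure is defined separately. *)
Definition dotr (R : realType) (d : nat) (u v : 'rV[R]_d) : R :=
  \sum_(j < d) u 0 j * v 0 j.

Definition enorm (R : realType) (d : nat) (u : 'rV[R]_d) : R :=
  Num.sqrt (dotr u u).

Definition grad (R : realType) (d : nat) (g : 'rV[R]_d -> R) (x : 'rV[R]_d) :
  'rV[R]_d := \row_(j < d) 'D_(delta_mx 0 j) g x.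

Definition dom (R : realType) (d : nat) (h : 'rV[R]_d -> \bar R) :
  set 'rV[R]_d := [set x | (h x < +oo)%E].

Definition proper (R : realType) (d : nat) (h : 'rV[R]_d -> \bar R) : Prop :=
  (forall x, (-oo < h x)%E) /\ dom h !=set0.

Definition econvex (R : realType) (d : nat) (h : 'rV[R]_d -> \bar R) : Prop :=
  forall (x y : 'rV[R]_d) (t : R), 0 <= t <= 1 ->
    (h (t *: x + (1 - t) *: y)%R <= t%:E * h x + (1 - t)%R%:E * h y)%E.

Definition weakly_convex (R : realType) (d : nat) (rho : R)
    (h : 'rV[R]_d -> \bar R) : Prop :=
  econvex (fun x => (h x + (rho / 2 * enorm x ^+ 2)%R%:E)%E).

(* Frechet subdifferential; empty outside the domain. The term o(|y - x|) is
   spelled out with an arbitrary slope e > 0. *)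
Definition subdiff (R : realType) (d : nat) (h : 'rV[R]_d -> \bar R)
    (x : 'rV[R]_d) : set 'rV[R]_d :=
  [set g | dom h x /\ forall e : R, 0 < e ->
    \forall y \near x,
      (h x + (dotr g (y - x) - e * enorm (y - x))%R%:E <= h y)%E].

(* dist(0, S), equal to +oo when S is empty. *)
Definition dist0 (R : realType) (d : nat) (S : set 'rV[R]_d) : \bar R :=
  ereal_inf [set (enorm g)%:E | g in S].

Definition KL_with (R : realType) (d : nat) (h : 'rV[R]_d -> \bar R)
    (x : 'rV[R]_d) (theta c : R) : Prop :=
  [/\ 0 <= theta < 1, 0 < c, dom h x &
    exists2 eta : \bar R, (0 < eta)%E &
      \forall y \near x, (0 < `|h y - h x| < eta)%E ->
        (`|h y - h x| `^ theta <= c%:E * dist0 (subdiff h y))%E].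

Definition KL_property (R : realType) (d : nat) (h : 'rV[R]_d -> \bar R)
    (x : 'rV[R]_d) : Prop :=
  exists theta c : R, KL_with h x theta c.

(* The argmin as a set: [prox lambda phi x y] reads y = prox_(lambda phi)(x). *)
Definition prox (R : realType) (d : nat) (lambda : R)
    (phi : 'rV[R]_d -> \bar R) (x : 'rV[R]_d) : set 'rV[R]_d :=
  [set y | forall y' : 'rV[R]_d,
    (phi y + ((2 * lambda)^-1 * enorm (x - y) ^+ 2)%R%:E <=
     phi y' + ((2 * lambda)^-1 * enorm (x - y') ^+ 2)%R%:E)%E].

Definition favg (R : realType) (d n : nat) (f : 'I_n -> 'rV[R]_d -> R)
    (x : 'rV[R]_d) : R := n%:R^-1 * \sum_(i < n) f i x.

Definition objective (R : realType) (d n : nat) (f : 'I_n -> 'rV[R]_d -> R)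
    (phi : 'rV[R]_d -> \bar R) (x : 'rV[R]_d) : \bar R :=
  ((favg f x)%:E + phi x)%E.

(* The sequences z and w are produced by norm-PRR. The outer counter k starts
   at 1, so z 0 and w 0 are unused; [zi i] and [wi i] are the inner iterates
   z^k_(i+1) and w^k_(i+1), 0 <= i <= n, and [n] is indexed by 'I_n. *)
Definition normPRR (R : realType) (d n : nat) (f : 'I_n -> 'rV[R]_d -> R)
    (phi : 'rV[R]_d -> \bar R) (lambda : R) (alpha : nat -> R)
    (pi : nat -> 'S_n) (z w : nat -> 'rV[R]_d) : Prop :=
  prox lambda phi (z 1) (w 1) /\
  forall k : nat, (0 < k)%N ->
    exists zi wi : nat -> 'rV[R]_d,
      [/\ zi 0 = z k /\ wi 0 = w k,
          forall i : 'I_n,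
            zi i.+1 = zi i - alpha k *:
              (grad (f (pi k i)) (wi i) + lambda^-1 *: (zi i - wi i)),
          forall i : 'I_n, prox lambda phi (zi i.+1) (wi i.+1) &
          z k.+1 = zi n /\ w k.+1 = wi n].

Definition tauPRR (R : realType) (rho L lambda : R) : R :=
  (1 - 4 * lambda * rho) /
  (2 * (1 - 2 * lambda * rho + lambda ^+ 2 * L ^+ 2)).

(* u k = O(k ^ (- p)) as k -> oo for an extended real sequence u, which in
   particular has to be eventually finite. *)
Definition bigO_rate (R : realType) (u : nat -> \bar R) (p : R) : Prop :=
  (\forall k \near \oo, u k \is a fin_num) /\
  (fun k => fine (u k)) =O_\oo (fun k : nat => (k%:R : R) `^ (- p)).

(* Main.v *)
(* Write F_k for the natural residual (z^k - w^k) / lambda + grad f (w^k), an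
   element of the subdifferential of psi at w^k, p_k = w^(k+1) - w^k and
   a_k = n alpha_k. One epoch is an inexact step z^(k+1) = z^k - a_k F_k + e_k
   with |e_k| = O(a_k^2 (1 + |F_k|)), so that for every t in ]0, tau] the merit
   function psi(w^k) + t lambda / 2 |F_k|^2 decreases by at least
   t a_k / 8 |F_k|^2 + |p_k|^2 / (8 a_k), up to an error O(a_k^3). Adding
   u_k = Cu k^-(3 gamma - 1) absorbs the errors and gives nonincreasing
   sequences. The values t = tau and t = tau / 2 together show that |F_k|^2
   converges, hence tends to 0 because the a_k are not summable. Let G_k be the
   gap of the corrected merit function (t = tau) to its limit.

   The KL exponent may always be raised to th >= gamma / (3 gamma - 1) >= 1/2.
   The KL inequality then gives G_k^th = O(|F_k| + u_k^th), and concavity of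
   s^(1 - th) turns the descent into |p_k| <= Z_k - Z_(k+1) with
   Z_k = C2 G_k^(1 - th) + C4 k^-(gamma + th (3 gamma - 1) - 1). This traps the
   iterates near an accumulation point w* and yields |w^k - w*| <= Z_k. The rate
   of G_k follows from G_(k+1) <= G_k - c a_k G_k^(2 th) + C a_k u_k^(2 th); it
   bounds |F_k|^2 as well, since the gap for t = tau / 2 is nonnegative. *)
Require Import Defs.
From mathcomp Require Import ring lra.

Set Implicit Arguments.
Unset Strict Implicit.
Unset Printing Implicit Defensive.

Local Open Scope classical_set_scope.
Local Open Scope ring_scope.


(** * Real powers and rates of recursive sequences *)

(** Each inner update follows a direction [grad (f i) w + (z - w) / lambda] that is Lipschitz in z
    along the proximal map. Frozen at the start of the epoch, these directions add up to n times the
    normal map for every permutation, so the order of the components only enters an error of second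
    order in the step.

    [phi] is merely lower semicontinuous and may be infinite. Gradients are therefore compared only
    inside the convex set [dom phi], and the value at a cluster point is pinned from one side by
    semicontinuity and from the other by the proximal inequality with a bounded residual.

    The threshold gamma / (3 gamma - 1) is the KL exponent at which the KL rate (1 - gamma) / (2 th
    - 1) equals the error rate 3 gamma - 1. Below it the errors dominate, so raising the exponent
    costs nothing in the stated rates. For gamma = 1 the condition on alpha is quantitative: the KL
    constant must survive unchanged, which is why that case has its own recursion. *)

Section RealPowers.
Variable R : realType.
Implicit Types (p r s t th : R) (k : nat).

(** The tangent inequality of the concave map s^(1 - th), multiplied by s^th. Young's inequality
    with exponents 1 / (1 - th) and 1 / th proves it without a derivative, so s = 0 is included. *)
Lemma powR_tangent th s t : 0 < th < 1 -> 0 <= s -> 0 <= t ->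
  (1 - th) * (s - t) <= (s `^ (1 - th) - t `^ (1 - th)) * s `^ th.
Proof.
move=> /andP[th0 th1] s0 t0.
have th1' : 0 < 1 - th by rewrite subr_gt0.
have sE : s `^ (1 - th) * s `^ th = s.
  rewrite -powRD ?subrK ?powRr1//.
  by rewrite oner_eq0.
have : t `^ (1 - th) * s `^ th <= (1 - th) * t + th * s.
  have := @conjugate_powR R (t `^ (1 - th)) (s `^ th) (1 - th)^-1 th^-1.
  rewrite !powR_ge0 !invr_gt0 !invrK -!powRrM !mulfV ?gt_eqF//.
  rewrite !powRr1// subrK [t * _]mulrC [s * _]mulrC; exact.
move=> H; rewrite [leRHS]mulrBl sE; lra.
Qed.

(** Mean value theorem on [k, k + 1]; the factor 2^(-p - 1) comes from k + 1 <= 2 k. The lower bound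
    lets a tail C k^-p absorb errors of order k^(-p - 1); the upper bound is the decrease that an
    induction on M k^-p has to beat. *)
Lemma powRN_step p k : 0 < p -> (0 < k)%N ->
  p * 2 `^ (- p - 1) * k%:R `^ (- p - 1) <= k%:R `^ (- p) - k.+1%:R `^ (- p)
    <= p * k%:R `^ (- p - 1).
Proof.
move=> p0 k0.
have kR0 : 0 < k%:R :> R by rewrite ltr0n.
have kk : k%:R < k.+1%:R :> R by rewrite ltr_nat.
have [|c|c] := @MVT R (fun x => x `^ (- p)) (fun x => - p * x `^ (- p - 1)) _ _ kk.
- by move=> x; rewrite in_itv/= => /andP[kx _]; apply: is_derive1_powR; exact: lt_trans kx.
- apply: continuous_in_subspaceT => x; rewrite inE/= in_itv/= => /andP[kx _].
  apply/differentiable_continuous/derivable1_diffP/derivable_powR.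
  by rewrite in_itv/= andbT; exact: lt_le_trans kx.
rewrite in_itv/= => /andP[kc ck] E.
have -> : k%:R `^ (- p) - k.+1%:R `^ (- p) = p * c `^ (- p - 1).
  by rewrite -opprB E -natr1; ring.
have c0 : 0 < c by exact: lt_trans kc.
have H (x y : R) : 0 < x -> x <= y -> y `^ (- p - 1) <= x `^ (- p - 1).
  move=> x0 xy; rewrite -opprD !powRN lef_pV2 ?posrE ?powR_gt0//; last exact: lt_le_trans xy.
  apply: ge0_ler_powR => //; rewrite ?nnegrE ?addr_ge0 ?(ltW p0) ?(ltW x0)//.
  exact: le_trans (ltW x0) xy.
rewrite -mulrA !(ler_pM2l p0) H ?(ltW kc)// -powRM ?ler0n// H//.
have : 1 <= k%:R :> R by rewrite ler1n.
by move: ck; rewrite -natr1; lra.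
Qed.

Lemma powRN_lt p e : 0 < p -> 0 < e -> \forall k \near \oo, (k%:R : R) `^ (- p) < e.
Proof.
move=> p0 e0.
near=> k.
have kl : e^-1 `^ p^-1 < k%:R by near: k; exact: nbhs_infty_gtr.
rewrite powRN invf_plt ?posrE ?powR_gt0//; last first.
  exact: le_lt_trans (powR_ge0 _ _) kl.
have -> : e^-1 = (e^-1 `^ p^-1) `^ p.
  by rewrite -powRrM mulVf ?gt_eqF// powRr1// invr_ge0 ltW.
by apply: gt0_ltr_powR; rewrite ?nnegrE ?powR_ge0.
Unshelve. all: by end_near.
Qed.

Lemma near_lt0n : \forall k \near \oo, (0 < k)%N.
Proof. by exists 1%N. Qed.

Lemma nonincreasing_from (u : nat -> R) :
  (\forall k \near \oo, u k.+1 <= u k) ->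
  exists K, forall k m, (K <= k)%N -> (k <= m)%N -> u m <= u k.
Proof.
move=> [K _ H]; exists K => k m Kk; elim: m => [|m IH].
  by rewrite leqn0 => /eqP ->.
rewrite leq_eqVlt => /predU1P[->//|]; rewrite ltnS => km.
by apply: le_trans (IH km); apply: H => /=; exact: leq_trans km.
Qed.

Lemma nonincreasing_cvg (u : nat -> R) (m : R) :
  (\forall k \near \oo, u k.+1 <= u k) -> (\forall k \near \oo, m <= u k) -> 
  cvgn u /\ \forall k \near \oo, limn u <= u k.
Proof.
move=> /nonincreasing_from[K HK] um.
have cu : cvgn u.
  apply: (@near_nonincreasing_is_cvgn _ u m) => //.
  by exists K => // k /= Kk i ki; exact: HK.
split=> //; exists K => // k /= Kk.
apply: limr_le => //; exists k => // m' /= km; exact: HK.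
Qed.

End RealPowers.


(** * Decay rates forced by recursive inequalities *)

Section Rates.
Variable R : realType.
Implicit Types (p r s t th : R) (k : nat).

(* Since [G] decreases, the induction step is only needed when
   [G k >= M (k + 1)^-r], which is a lower bound to be fed to the recursion. *)
Lemma rate_induction (G : nat -> R) r (M0 : R) : 0 < r ->
  (\forall k \near \oo, G k.+1 <= G k) ->
  (\forall k \near \oo, forall M, M0 <= M -> M * k.+1%:R `^ (- r) <= G k ->
     G k.+1 <= G k - M * r * k%:R `^ (- r - 1)) ->
  exists M, \forall k \near \oo, G k <= M * k%:R `^ (- r).
Proof.
move=> r0 Gdec step.
have [K _ HK] : \forall k \near \oo, [/\ (0 < k)%N, G k.+1 <= G k &
    forall M, M0 <= M -> M * k.+1%:R `^ (- r) <= G k ->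
     G k.+1 <= G k - M * r * k%:R `^ (- r - 1)].
  near=> k; split; [by near: k; exists 1%N|by near: k|by near: k].
pose M := Num.max (Num.max M0 0) (G K * K%:R `^ r).
have [K0 _ _] := HK K (leqnn K).
have M0M : M0 <= M by rewrite /M !le_max lexx.
have Mge0 : 0 <= M by rewrite /M !le_max lexx orbT.
exists M; exists K => // k /= Kk.
have {k Kk} [j ->] : exists j, k = (K + j)%N by exists (k - K)%N; rewrite subnKC.
elim: j => [|j IH].
  rewrite addn0 powRN ler_pdivlMr ?powR_gt0 ?ltr0n//.
  by rewrite /M !le_max lexx orbT.
have [k0 dec] := HK (K + j)%N (leq_addr _ _).
move=> /(_ M M0M); rewrite -!addnS in dec *.
have [le|lt] := leP (M * (K + j.+1)%:R `^ (- r)) (G (K + j)%N); last first.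
  by move=> _; apply: le_trans dec (ltW lt).
move=> /(_ isT) H; apply: le_trans H _.
have /andP[_] := powRN_step r0 k0.
rewrite -addnS => ineq.
have := ler_wpM2l Mge0 ineq.
rewrite mulrBr mulrA; lra.
Unshelve. all: by end_near.
Qed.

(** The relation gam + r s = r + 1 gives k^-gam (k^-r)^s the order k^(-r - 1) of one decrement of
    k^-r. At G = M k^-r the contraction grows like M^s and the decrement like M, so a large M wins
    because s > 1. *)
Lemma rate_superlinear (G : nat -> R) (c C gam s r : R) :
  0 < c -> 1 < s -> 0 < r -> gam + r * s = r + 1 ->
  (\forall k \near \oo, G k.+1 <= G k) ->
  (\forall k \near \oo, 0 <= G k /\
     G k.+1 <= G k - c * k%:R `^ (- gam) * G k `^ s + C * k%:R `^ (- r - 1)) ->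
  exists M, \forall k \near \oo, G k <= M * k%:R `^ (- r).
Proof.
move=> c0 s1 r0 E Gdec step.
have s0 : 0 < s by exact: lt_trans s1.
(* The power of 2 pays for k + 1 <= 2 k. [M0] then solves c' M^(s - 1) >= r + |C|, with M >= 1 so
   that |C| <= |C| M. *)
pose c' := c * 2 `^ (- (r * s)).
have c'0 : 0 < c' by rewrite mulr_gt0 ?powR_gt0.
pose M0 := Num.max 1 (((r + `|C|) / c') `^ (s - 1)^-1).
apply: (rate_induction (r := r) (M0 := M0)) => //.
near=> k => M M0M HM.
have k0 : (0 < k)%N by near: k; exact: near_lt0n.
have [Gk0 Gk] : 0 <= G k /\
     G k.+1 <= G k - c * k%:R `^ (- gam) * G k `^ s + C * k%:R `^ (- r - 1).
  by near: k.
apply: le_trans Gk _.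
have M1 : 1 <= M by apply: le_trans M0M; rewrite le_max lexx.
have Mge0 : 0 <= M by exact: le_trans M1.
have HMs : r + `|C| <= c' * M `^ (s - 1).
  rewrite mulrC -ler_pdivrMr//.
  have -> : (r + `|C|) / c' = (((r + `|C|) / c') `^ (s - 1)^-1) `^ (s - 1).
    by rewrite -powRrM mulVf ?subr_eq0 ?gt_eqF// powRr1// divr_ge0 ?addr_ge0 ?(ltW r0) ?(ltW c'0).
  apply: ge0_ler_powR; rewrite ?nnegrE ?powR_ge0 ?subr_ge0 ?(ltW s1)//.
  by apply: le_trans M0M; rewrite le_max lexx orbT.
have HG : M `^ s * (2 `^ (- (r * s)) * k%:R `^ (- (r * s))) <= G k `^ s.
  have -> : M `^ s * (2 `^ (- (r * s)) * k%:R `^ (- (r * s))) =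
     (M * (2 * k%:R) `^ (- r)) `^ s.
    rewrite (@powRM _ M) ?powR_ge0//; congr (_ * _).
    by rewrite -powRrM mulNr powRM.
  apply: ge0_ler_powR; rewrite ?nnegrE ?mulr_ge0 ?powR_ge0 ?(ltW s0)//.
  apply: le_trans HM; rewrite ler_wpM2l// !powRN lef_pV2 ?posrE ?powR_gt0 ?mulr_gt0 ?ltr0n//.
  apply: ge0_ler_powR; rewrite ?nnegrE ?ler0n ?mulr_ge0 ?(ltW r0)//.
  by rewrite -[2 * _]/(2%:R * _) -natrM ler_nat mul2n -addnn -addn1 leq_add2l.
have HM' : M `^ s = M * M `^ (s - 1) by rewrite mulr_powRB1.
have kE : k%:R `^ (- gam) * k%:R `^ (- (r * s)) = k%:R `^ (- r - 1) :> R.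
  rewrite -powRD; last by rewrite pnatr_eq0 -lt0n k0 implybT.
  by congr powR; rewrite -opprD E opprD.
set x := k%:R `^ (- r - 1) in kE *.
have x0 : 0 <= x by exact: powR_ge0.
have : c * k%:R `^ (- gam) * (M `^ s * (2 `^ (- (r * s)) * k%:R `^ (- (r * s)))) <=
       c * k%:R `^ (- gam) * G k `^ s.
  by rewrite ler_wpM2l// mulr_ge0 ?powR_ge0 ?ltW.
have -> : c * k%:R `^ (- gam) * (M `^ s * (2 `^ (- (r * s)) * k%:R `^ (- (r * s)))) = 
  (c' * M `^ (s - 1)) * M * x by rewrite -kE HM' /c'; ring.
have : (r + `|C|) * (M * x) <= c' * M `^ (s - 1) * (M * x).
  by rewrite ler_wpM2r// mulr_ge0.
have : C * x <= `|C| * (M * x).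
  apply: (@le_trans _ _ (`|C| * x)); first by rewrite ler_wpM2r// ler_norm.
  by rewrite ler_wpM2l// ler_peMl.
lra.
Unshelve. all: by end_near.
Qed.

(** The borderline s = 1, where enlarging M gains nothing on the decrement and only the excess q - 2
    is available. Half of it, [del], dominates the error C; the other half covers the passage from k
    to k + 1. *)
Lemma rate_linear (G : nat -> R) (q C : R) : 2 < q ->
  (\forall k \near \oo, G k.+1 <= G k) ->
  (\forall k \near \oo, 0 <= G k /\
     G k.+1 <= G k - q * k%:R^-1 * G k + C * k%:R `^ (- 2 - 1)) ->
  exists M, \forall k \near \oo, G k <= M * k%:R `^ (- 2).
Proof.
move=> q2 Gdec step.
pose del := (q - 2) / 2.
have del0 : 0 < del by rewrite divr_gt0 ?subr_gt0.
apply: (rate_induction (r := 2) (M0 := `|C| / del)) => //.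
near=> k => M M0M HM.
have k0 : (0 < k)%N by near: k; exact: near_lt0n.
have kR0 : 0 < k%:R :> R by rewrite ltr0n.
have [Gk0 Gk] : 0 <= G k /\
   G k.+1 <= G k - q * k%:R^-1 * G k + C * k%:R `^ (- 2 - 1) by near: k.
apply: le_trans Gk _.
(* Large enough for q k^2 >= (2 + del) (k + 1)^2. *)
have kbig : 4 * q / del <= k%:R by near: k; exact: nbhs_infty_ger.
have kE : k%:R `^ (- 2 - 1) = k%:R ^- 3 :> R.
  by rewrite -opprD natr1 -[2.+1%:R]/(3%:R) powRN powR_mulrn ?ler0n.
rewrite kE; rewrite powRN powR_mulrn ?ler0n// in HM.
have MC : `|C| <= M * del by rewrite -ler_pdivrMr.
have CM : C <= M * del by exact: le_trans (ler_norm _) MC.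
have Mge0 : 0 <= M by apply: le_trans M0M; rewrite divr_ge0// ltW.
have H1 : q * k%:R^-1 * (M * k.+1%:R ^- 2) <= q * k%:R^-1 * G k.
  by rewrite ler_wpM2l// mulr_ge0 ?invr_ge0 ?ler0n//; lra.
suff H2 : M * (2 + del) * k%:R ^- 3 <= q * k%:R^-1 * (M * k.+1%:R ^- 2).
  have : C * k%:R ^- 3 <= M * del * k%:R ^- 3.
    by rewrite ler_wpM2r// invr_ge0 exprn_ge0.
  move: H1 H2; set A := q * k%:R^-1 * (M * _); set B := q * _ * G k.
  by set x := k%:R ^- 3; lra.
have -> : q * k%:R^-1 * (M * k.+1%:R ^- 2) =
   M * (q * (k%:R ^+ 2 / k.+1%:R ^+ 2)) * k%:R ^- 3.
  have := gt_eqF kR0; have : k.+1%:R != 0 :> R by rewrite pnatr_eq0.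
  move: (k.+1%:R : R) (k%:R : R) => y x y0 x0; field; by rewrite y0 x0.

rewrite ler_wpM2r ?invr_ge0 ?exprn_ge0// ler_wpM2l//.
rewrite mulrA ler_pdivlMr ?exprn_gt0// -natr1.
have k1 : 1 <= k%:R :> R by rewrite ler1n.
have : 4 * q <= del * k%:R by rewrite [leRHS]mulrC -ler_pdivrMr.
rewrite /del; set x := k%:R; move: k1; rewrite -/x => k1 H; nra.
Unshelve. all: by end_near.
Qed.

End Rates.


(** * Kurdyka-Lojasiewicz arguments for scalar sequences *)

Section Merit.
Variable R : realType.
Implicit Types (k : nat).

(** The bound on [p] is only available while D < r, so confinement and finite length are proved
    together: from an index where D and Z are both below e / 2, the remaining path has length at
    most Z, and D never reaches e. *)
Lemma trapping (D p Z : nat -> R) r : 0 < r ->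
  (\forall k \near \oo, 0 <= Z k) -> Z @ \oo --> (0 : R) ->
  (\forall k \near \oo, `|D k.+1 - D k| <= p k) ->
  (\forall k \near \oo, D k < r -> p k <= Z k - Z k.+1) ->
  (forall e N, 0 < e -> exists2 k, (N <= k)%N & D k < e) ->
  (forall k, 0 <= D k) ->
  D @ \oo --> (0 : R) /\ \forall k \near \oo, D k <= Z k.
Proof.
move=> r0 Z0 cZ Dp pZ freq D0.
have [K _ HK] : \forall k \near \oo,
    [/\ 0 <= Z k, `|D k.+1 - D k| <= p k & D k < r -> p k <= Z k - Z k.+1].
  by near=> k; split; near: k.
have trap e : 0 < e -> e <= r ->
    exists N, (K <= N)%N /\ forall k, (N <= k)%N -> D k < e.
  move=> e0 er.
  have e20 : 0 < e / 2 by rewrite divr_gt0.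
  have [N _ HN] : \forall k \near \oo, Z k < e / 2.
    have /cvgr_lt := cZ; exact.
  have [m mN Dm] := freq (e / 2) (maxn K N) e20.
  move: mN; rewrite geq_max => /andP[Km Nm].
  exists m; split=> // k mk.
  suff : D k <= D m + (Z m - Z k) /\ D k < e by case.
  have {k mk} [j ->] : exists j, k = (m + j)%N by exists (k - m)%N; rewrite subnKC.
  have Zm := HN m Nm.
  elim: j => [|j [IH1 IH2]].
    by rewrite addn0; split; lra.
  have [Zk Dk Dr] := HK (m + j)%N (leq_trans Km (leq_addr _ _)).
  have [Zk1 _ _] := HK (m + j.+1)%N (leq_trans Km (leq_addr _ _)).
  rewrite -!addnS in Dk Dr.
  have := Dr (lt_le_trans IH2 er); move: Dk; rewrite ler_norml => /andP[_ Dk] pk.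
  by split; lra.
have cD : D @ \oo --> (0 : R).
  apply/cvgrPdist_lt => e e0.
  have [N [_ HN]] : exists N, (K <= N)%N /\ forall k, (N <= k)%N -> D k < Num.min e r.
    by apply: trap; rewrite ?lt_min ?e0 ?ge_min ?lexx ?orbT.
  exists N => // k /= Nk; rewrite sub0r normrN ger0_norm//.
  by have := HN k Nk; rewrite lt_min => /andP[].
split=> //.
have [N [KN HN]] := trap r r0 (lexx _).
exists N => // k /= Nk.
have H m : (k <= m)%N -> D k <= D m + (Z k - Z m).
  move=> km; have {m km} [j ->] : exists j, m = (k + j)%N by exists (m - k)%N; rewrite subnKC.
  elim: j => [|j IH]; first by rewrite addn0 subrr addr0.
  have kj : (N <= k + j)%N by exact: leq_trans Nk (leq_addr _ _).
  have [Zk Dk /(_ (HN _ kj))] := HK (k + j)%N (leq_trans KN kj).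
  move: Dk; rewrite ler_norml -!addnS => /andP[Dk _] Dr; lra.
apply/ler_addgt0Pl => e e0.
have [M _ HM] : \forall m \near \oo, D m < e by have /cvgr_lt := cD; exact.
pose m := maxn k M.
have [Zm _ _] := HK m (leq_trans (leq_trans KN Nk) (leq_maxl _ _)).
have := H m (leq_maxl _ _).
have := HM m (leq_maxr _ _).
lra.
Unshelve. all: by end_near.
Qed.

(** A sum of three terms is at most three times the largest one, and powers commute with the
    maximum. The quadratic term becomes linear, X^(2 th) <= X, because X <= 1 and th >= 1/2. *)
Lemma KL_bound (G S X u c cX th : R) :
  0 < th < 1 -> 1 <= 2 * th -> 0 <= c -> 0 <= cX -> 0 <= u -> 0 <= X <= 1 ->
  0 <= G -> 0 <= S -> G <= S + cX * X ^+ 2 + u -> S `^ th <= c * X ->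
  G `^ th <= (3 * (c + cX `^ th) + 3) * (X + u `^ th).
Proof.
move=> /andP[th0 th1] th2 c0 cX0 u0 /andP[X0 X1] G0 S0 GS KL.
set U := u `^ th; have U0 : 0 <= U by exact: powR_ge0.
have X2 : (cX * X ^+ 2) `^ th <= cX `^ th * X.
  rewrite powRM ?sqr_ge0// ler_wpM2l ?powR_ge0//.
  rewrite -powR_mulrn// -powRrM.
  move: X0; rewrite le_eqVlt => /predU1P[<-|X0].
    by rewrite powR0// gt_eqF// mulr_gt0.
  by apply: le_trans (ger_powR _ th2) _; rewrite ?X0// powRr1// ltW.
have cXX : 0 <= cX * X ^+ 2 by rewrite mulr_ge0 ?sqr_ge0.
pose M := Num.max S (Num.max (cX * X ^+ 2) u).
have M0 : 0 <= M by rewrite le_max S0.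
have GM : G <= 3 * M.
  apply: le_trans GS _.
  have : S <= M by rewrite le_max lexx.
  have : cX * X ^+ 2 <= M by rewrite !le_max lexx orbT.
  have : u <= M by rewrite !le_max lexx !orbT.
  lra.
apply: (@le_trans _ _ ((3 * M) `^ th)).
  by apply: ge0_ler_powR; rewrite ?nnegrE ?mulr_ge0 ?(ltW th0).
rewrite powRM//.
have Mth : M `^ th <= S `^ th + (cX * X ^+ 2) `^ th + U.
  have ? := powR_ge0 S th; have ? := powR_ge0 (cX * X ^+ 2) th.
  rewrite /M; case: (leP S) => _; last by lra.
  by case: (leP (cX * X ^+ 2) u) => _; rewrite -?/U; lra.
have H3 : 3 `^ th <= 3 :> R by apply: ler1_powR; lra.
have M3 : 3 `^ th * M `^ th <= 3 * M `^ th by rewrite ler_wpM2r ?powR_ge0.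
apply: le_trans M3 _.
apply: (@le_trans _ _ (3 * (c * X + cX `^ th * X + U))); first by rewrite ler_wpM2l//; lra.
have cU : 0 <= c * U by rewrite mulr_ge0.
have cXU : 0 <= cX `^ th * U by rewrite mulr_ge0 ?powR_ge0.
by lra.
Qed.

(** By concavity, (1 - th) (G - G') is at most B (X + u^th) times the decrease of G^(1 - th).
    Inserted in the descent this is a quadratic inequality in a X and p; completing the square
    eliminates a X. *)
Lemma KL_step (G G' S X u a p c tau cX th : R) :
  0 < th < 1 -> 1 <= 2 * th -> 0 < a -> 0 < tau -> 0 <= c -> 0 <= cX ->
  0 <= u -> 0 <= p -> 0 <= X <= 1 -> 0 <= G' -> 0 <= S -> G <= S + cX * X ^+ 2 + u ->
  S `^ th <= c * X ->
  G' <= G - tau * a / 8 * X ^+ 2 - p ^+ 2 / (8 * a) ->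
  p <= 4 * ((3 * (c + cX `^ th) + 3) / (1 - th)) * (1 + tau^-1)
         * (G `^ (1 - th) - G' `^ (1 - th)) + a * u `^ th.
Proof.
move=> /andP[th0 th1] th2 a0 tau0 c0 cX0 u0 p0 /andP[X0 X1] G'0 S0 GS KL desc.
have th1' : 0 < 1 - th by rewrite subr_gt0.
set B := 3 * (c + cX `^ th) + 3.
have B0 : 0 < B.
  by have := powR_ge0 cX th; rewrite /B; lra.
set U := u `^ th; have U0 : 0 <= U by exact: powR_ge0.
set Del := G `^ (1 - th) - G' `^ (1 - th).
have pa0 : 0 <= p ^+ 2 / (8 * a) by rewrite divr_ge0 ?sqr_ge0// mulr_ge0// ltW.
have Xa0 : 0 <= tau * a / 8 * X ^+ 2.
  by rewrite mulr_ge0 ?sqr_ge0// divr_ge0// mulr_ge0 ?(ltW tau0) ?(ltW a0).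
have GG' : G' <= G by lra.
have G0 : 0 <= G by lra.
have Del0 : 0 <= Del.
  by rewrite subr_ge0 ge0_ler_powR ?nnegrE ?(ltW th1').
have GB : G `^ th <= B * (X + U).
  by apply: KL_bound GS KL; rewrite ?th0 ?th1 ?X0 ?X1.
have key : (1 - th) * (G - G') <= Del * (B * (X + U)).
  apply: le_trans (powR_tangent _ _ _) _; rewrite ?th0 ?th1//.
  by rewrite ler_wpM2l.
set D0 := B / (1 - th).
have D00 : 0 < D0 by rewrite divr_gt0.
have key2 : tau * a / 8 * X ^+ 2 + p ^+ 2 / (8 * a) <= D0 * Del * (X + U).
  apply: (@le_trans _ _ (G - G')); first by lra.
  have -> : D0 * Del * (X + U) = (Del * (B * (X + U))) / (1 - th) by rewrite /D0; ring.
  by rewrite ler_pdivlMr// mulrC.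
have key3 : tau * (a * X) ^+ 2 + p ^+ 2 <= 8 * D0 * Del * (a * X + a * U).
  have -> : tau * (a * X) ^+ 2 + p ^+ 2 = 8 * a * (tau * a / 8 * X ^+ 2 + p ^+ 2 / (8 * a)).
    by field; rewrite gt_eqF.
  have -> : 8 * D0 * Del * (a * X + a * U) = 8 * a * (D0 * Del * (X + U)) by ring.
  by rewrite ler_pM2l// mulr_gt0.
move: key3; set y := a * X; set v := a * U => key3.
have v0 : 0 <= v by rewrite mulr_ge0// ltW.
have ti0 : 0 < tau^-1 by rewrite invr_gt0.
set E := D0 * Del; have E0 : 0 <= E by rewrite mulr_ge0// ltW.
have -> : 4 * D0 * (1 + tau^-1) * Del = 4 * (1 + tau^-1) * E by rewrite /E; ring.
(* Young's inequality, weighted so that tau y^2 cancels against the left side of [key3]. *)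
have key4 : 8 * E * y <= tau * y ^+ 2 + 16 * tau^-1 * E ^+ 2.
  have : 0 <= tau * (y - 4 * tau^-1 * E) ^+ 2 by rewrite mulr_ge0 ?sqr_ge0// ltW.
  have -> : tau * (y - 4 * tau^-1 * E) ^+ 2 =
    tau * y ^+ 2 - 8 * E * y + 16 * tau^-1 * E ^+ 2 by field; rewrite gt_eqF.
  lra.
rewrite -[8 * D0 * Del]mulrA -/E in key3.
set ti := tau^-1 in ti0 key4 *.
have t1 : 0 <= 1 + ti by lra.
have rhs0 : 0 <= 4 * (1 + ti) * E + v.
  by rewrite addr_ge0// mulr_ge0// mulr_ge0.
rewrite -(@ler_pXn2r _ 2) ?nnegrE//.
have := sqr_ge0 E; have : 0 <= ti * E ^+ 2 by rewrite mulr_ge0 ?sqr_ge0// ?(ltW ti0).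
have : 0 <= ti * ti * E ^+ 2 by rewrite mulr_ge0 ?sqr_ge0// mulr_ge0// ltW.
have : 0 <= E * v by rewrite mulr_ge0.
have : 0 <= ti * E * v by rewrite mulr_ge0// mulr_ge0// ltW.
have := sqr_ge0 v; lra.
Qed.

End Merit.


(** * Limit of the merit function and vanishing of the residual *)

Section MeritLimit.
Variable R : realType.
Implicit Types (k : nat).

(** Divergence of the harmonic series through the logarithm: ln (k + 1) <= ln k + 1 / k makes h + c
    ln k nonincreasing, whereas a lower bound on h would send it to infinity. *)
Lemma no_harmonic_descent (h : nat -> R) c lb : 0 < c ->
  (\forall k \near \oo, lb <= h k) ->
  (\forall k \near \oo, h k.+1 <= h k - c * k%:R^-1) -> False.
Proof.
move=> c0 hlb hstep.
pose v k := h k + c * ln (k%:R : R).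
have /nonincreasing_from[K HK] : \forall k \near \oo, v k.+1 <= v k.
  near=> k.
  have k0 : (0 < k)%N by near: k; exact: near_lt0n.
  have kR0 : 0 < k%:R :> R by rewrite ltr0n.
  have : h k.+1 <= h k - c * k%:R^-1 by near: k.
  have : ln (k.+1%:R : R) <= ln (k%:R : R) + k%:R^-1.
    have -> : k.+1%:R = k%:R * (1 + k%:R^-1) :> R.
      by rewrite mulrDr mulr1 mulfV ?gt_eqF// natr1.
    rewrite lnM ?posrE ?addr_gt0 ?invr_gt0// lerD2l le_ln1Dx//.
    by apply: lt_trans (_ : 0 < _); rewrite ?invr_gt0// ltrN10.
  move=> /(ler_wpM2l (ltW c0)); rewrite /v mulrDr; lra.
have [N _ HN] := hlb.
have [M _ HM] : \forall k \near \oo, expR ((v K - lb) / c) < k%:R :> R.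
  exact: nbhs_infty_gtr.
pose k := maxn (maxn K N) (maxn M 1).
have kK : (K <= k)%N by rewrite /k -maxnA leq_maxl.
have kN : (N <= k)%N by rewrite /k (leq_trans _ (leq_maxl _ _))// leq_maxr.
have kM : (M <= k)%N by rewrite /k (leq_trans _ (leq_maxr _ _))// leq_maxl.
have k1 : (0 < k)%N by rewrite /k (leq_trans _ (leq_maxr _ _))// leq_maxr.
have /= E := HM k kM.
have /= L := HN k kN.
have := HK K k (leqnn _) kK; rewrite /v -/(v K).
have : (v K - lb) / c < ln (k%:R : R).
  by rewrite -ltr_expR lnK// posrE ltr0n.
rewrite ltr_pdivrMr//; rewrite /v; lra.
Unshelve. all: by end_near.
Qed.

(* Using the descent for both [t = tau] and [t = tau / 2] makes [X k ^+ 2] the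
   difference of two convergent sequences. *)
Lemma merit_limit (S X p a : nat -> R) (lam tau gam alo ahi C lb : R) :
  0 < lam -> 0 < tau -> 2^-1 < gam <= 1 -> 0 < alo -> 0 <= C ->
  (\forall k \near \oo, alo * k%:R `^ (- gam) <= a k <= ahi * k%:R `^ (- gam)) ->
  (\forall k \near \oo, lb <= S k) ->
  (forall t, 0 < t <= tau -> \forall k \near \oo,
     S k.+1 + t * lam / 2 * X k.+1 ^+ 2 <= S k + t * lam / 2 * X k ^+ 2
       - t * a k / 8 * X k ^+ 2 - p k ^+ 2 / (8 * a k) + C * a k ^+ 3) ->
  exists Ss Cu, let u := fun k => Cu * k%:R `^ (- (3 * gam - 1)) in
   let G := fun k => S k - Ss + tau * lam / 2 * X k ^+ 2 + u k in
   [/\ 0 <= Cu,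
     \forall k \near \oo, G k.+1 <= G k - tau * a k / 8 * X k ^+ 2 - p k ^+ 2 / (8 * a k),
     \forall k \near \oo, tau * lam / 4 * X k ^+ 2 <= G k,
     G @ \oo --> 0 &
     \forall k \near \oo, `|S k - Ss| <= G k + u k].
Proof.
move=> lam0 tau0 /andP[gam2 gam1] alo0 C0 ha hlb hd.
pose q := 3 * gam - 1.
have q0 : 0 < q by rewrite /q; lra.
(* The errors C a^3 are at most C ahi^3 k^(-3 gam), and 3 gam = q + 1. [Cu] is what the lower bound
   of [powRN_step] requires for u k - u (k + 1) to cover them. *)
pose Cu := C * ahi ^+ 3 / (q * 2 `^ (- q - 1)).
have [K0 _ HK0] := ha.
have ahi0 : 0 <= ahi.
  have /andP[H1 H2] := HK0 (maxn K0 1) (leq_maxl _ _).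
  have x0 : 0 < (maxn K0 1)%:R `^ (- gam) :> R by rewrite powR_gt0// ltr0n leq_maxr.
  by rewrite -(pmulr_lge0 _ x0) (le_trans _ H2)// (le_trans _ H1)// mulr_ge0// ltW.
have Cu0 : 0 <= Cu.
  by rewrite divr_ge0 ?mulr_ge0 ?exprn_ge0 ?powR_ge0 ?(ltW q0).
pose u k := Cu * k%:R `^ (- q).
have u0 k : 0 <= u k by rewrite mulr_ge0 ?powR_ge0.
have ustep : \forall k \near \oo, C * a k ^+ 3 <= u k - u k.+1.
  near=> k.
  have k0 : (0 < k)%N by near: k; exact: near_lt0n.
  have /andP[ak0 ak] : alo * k%:R `^ (- gam) <= a k <= ahi * k%:R `^ (- gam) by near: k.
  have ak0' : 0 <= a k by apply: le_trans ak0; rewrite mulr_ge0 ?powR_ge0 ?ltW.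
  have /andP[+ _] := powRN_step q0 k0.
  move=> /(ler_wpM2l Cu0); rewrite mulrBr -/(u k) -/(u k.+1); apply: le_trans.
  apply: (@le_trans _ _ (C * (ahi * k%:R `^ (- gam)) ^+ 3)).
    by rewrite ler_wpM2l// lerXn2r ?nnegrE ?mulr_ge0 ?powR_ge0.
  rewrite exprMn -(powR_mulrn 3 (powR_ge0 _ _)) -powRrM.
  have -> : - gam * 3%:R = - q - 1 by rewrite /q; ring.
  rewrite /Cu [leRHS](_ : _ = C * (ahi ^+ 3 * k%:R `^ (- q - 1)))//.
  by field; rewrite !gt_eqF ?powR_gt0.
pose h t k := S k + t * lam / 2 * X k ^+ 2 + u k.
have hstep t : 0 < t <= tau -> \forall k \near \oo, h t k.+1 <= h t k
    - t * a k / 8 * X k ^+ 2 - p k ^+ 2 / (8 * a k).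
  move=> tt; near=> k.
  have : C * a k ^+ 3 <= u k - u k.+1 by near: k.
  have : S k.+1 + t * lam / 2 * X k.+1 ^+ 2 <= S k + t * lam / 2 * X k ^+ 2
       - t * a k / 8 * X k ^+ 2 - p k ^+ 2 / (8 * a k) + C * a k ^+ 3.
    by near: k; exact: hd.
  rewrite /h; lra.
have apos : \forall k \near \oo, 0 < a k.
  near=> k.
  have k0 : (0 < k)%N by near: k; exact: near_lt0n.
  have /andP[ak _] : alo * k%:R `^ (- gam) <= a k <= ahi * k%:R `^ (- gam) by near: k.
  by apply: lt_le_trans ak; rewrite mulr_gt0// powR_gt0// ltr0n.
have hlim t : 0 < t <= tau -> cvgn (h t) /\ \forall k \near \oo, limn (h t) <= h t k.
  move=> tt; have /andP[t0 _] := tt; apply: (@nonincreasing_cvg _ _ lb).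
    near=> k.
    have ak : 0 < a k by near: k.
    have : h t k.+1 <= h t k - t * a k / 8 * X k ^+ 2 - p k ^+ 2 / (8 * a k).
      by near: k; exact: hstep.
    have : 0 <= t * a k / 8 * X k ^+ 2 by rewrite mulr_ge0 ?sqr_ge0// divr_ge0// mulr_ge0// ?ltW.
    have : 0 <= p k ^+ 2 / (8 * a k) by rewrite divr_ge0 ?sqr_ge0// mulr_ge0// ltW.
    lra.
  near=> k.
  have : lb <= S k by near: k.
  have : 0 <= t * lam / 2 * X k ^+ 2 by rewrite mulr_ge0 ?sqr_ge0// divr_ge0// mulr_ge0// ?ltW.
  have := u0 k; rewrite /h; lra.
have tt1 : 0 < tau <= tau by rewrite tau0 lexx.
have tt2 : 0 < tau / 2 <= tau by lra.
have [c1 L1] := hlim _ tt1.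
have [c2 L2] := hlim _ tt2.
have lE : limn (h tau) = limn (h (tau / 2)).
  apply/eqP; rewrite eq_le; apply/andP; split; last first.
    apply: ler_lim => //; near=> k; rewrite /h lerD2r lerD2l ler_wpM2r ?sqr_ge0//.
    by rewrite ler_wpM2r// ler_wpM2r// ?(ltW lam0)//; lra.
  rewrite leNgt; apply/negP => lt.
  set dl := limn (h tau) - limn (h (tau / 2)).
  have dl0 : 0 < dl by rewrite subr_gt0.
  have cX : (fun k => h tau k - h (tau / 2) k) @ \oo --> dl by exact: cvgB.
  (* The two merit functions differ by tau lam / 4 X^2, which eventually exceeds dl / 2. Since gam
     <= 1, the descent is then at least of order 1 / k. *)
  have nX : \forall k \near \oo, 2 * dl / (tau * lam) <= X k ^+ 2.
    have dl2 : dl / 2 < dl by lra.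
    near=> k.
    have : dl / 2 < h tau k - h (tau / 2) k.
      by near: k; have /cvgr_gt := cX; exact.
    rewrite ler_pdivrMr ?mulr_gt0// /h; lra.
  apply: (@no_harmonic_descent (h tau) (tau * alo / 8 * (2 * dl / (tau * lam))) (limn (h tau))) => //.
    by rewrite mulr_gt0 ?divr_gt0 ?mulr_gt0.
  near=> k.
  have k0 : (0 < k)%N by near: k; exact: near_lt0n.
  have ak0 : 0 < a k by near: k.
  have /andP[ak _] : alo * k%:R `^ (- gam) <= a k <= ahi * k%:R `^ (- gam) by near: k.
  have : h tau k.+1 <= h tau k - tau * a k / 8 * X k ^+ 2 - p k ^+ 2 / (8 * a k).
    by near: k; exact: hstep.
  have : 0 <= p k ^+ 2 / (8 * a k) by rewrite divr_ge0 ?sqr_ge0// mulr_ge0// ltW.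
  have ki : k%:R^-1 <= k%:R `^ (- gam) :> R.
    by rewrite -powR_inv1 ?ler0n// ler_powR ?ler1n// lerN2.
  have Xk : 2 * dl / (tau * lam) <= X k ^+ 2 by near: k.
  have : tau * alo / 8 * (2 * dl / (tau * lam)) * k%:R^-1 <= tau * a k / 8 * X k ^+ 2.
    have -> : tau * alo / 8 * (2 * dl / (tau * lam)) * k%:R^-1 =
      tau / 8 * (alo * k%:R^-1) * (2 * dl / (tau * lam)) by ring.
    have -> : tau * a k / 8 * X k ^+ 2 = tau / 8 * a k * X k ^+ 2 by ring.
    apply: ler_pM => //.
    - by rewrite !mulr_ge0 ?invr_ge0 ?ler0n ?(ltW tau0) ?(ltW alo0).
    - by rewrite divr_ge0 ?mulr_ge0 ?(ltW tau0) ?(ltW lam0) ?(ltW dl0).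
    - rewrite ler_wpM2l ?divr_ge0 ?(ltW tau0)//.
      by apply: le_trans ak; rewrite ler_wpM2l// ltW.
  lra.
exists (limn (h tau)), Cu.
have hE t k : h t k = S k + t * lam / 2 * X k ^+ 2 + u k by [].
split => //=; rewrite -/q.
- near=> k.
  have : h tau k.+1 <= h tau k - tau * a k / 8 * X k ^+ 2 - p k ^+ 2 / (8 * a k).
    by near: k; exact: hstep.
  rewrite -/(u k) -/(u k.+1) !hE; lra.
(* G - tau lam / 4 X^2 is the gap of [h (tau / 2)] to the common limit. Its sign also bounds Ss - S
   by G + u in the last item. *)
- near=> k.
  have : limn (h (tau / 2)) <= h (tau / 2) k by near: k.
  rewrite -lE hE -/(u k); lra.
- rewrite [X in X @ _](_ : _ = fun k => h tau k - limn (h tau)).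
    by apply/subr_cvg0.
  by apply/funext => k; rewrite hE -/(u k); lra.
- near=> k.
  have : limn (h (tau / 2)) <= h (tau / 2) k by near: k.
  have : limn (h tau) <= h tau k by near: k.
  have : 0 <= tau * lam / 2 * X k ^+ 2.
    by rewrite mulr_ge0 ?sqr_ge0// divr_ge0// mulr_ge0 ?ltW.
  have := u0 k.
  rewrite -lE !hE -/(u k) ler_norml; lra.
Unshelve. all: by end_near.
Qed.

End MeritLimit.


(** * Path length and decay of the merit gap under the KL inequality *)

Section KLPath.
Variable R : realType.
Implicit Types (k : nat).

Lemma near_succ (P : nat -> Prop) :
  (\forall k \near \oo, P k) -> \forall k \near \oo, P k.+1.
Proof. by move=> [N _ H]; exists N => // k /= Nk; apply: H => /=; exact: leqW. Qed.

Lemma powR_seq_cvg0 (G : nat -> R) r : 0 < r -> (\forall k \near \oo, 0 <= G k) ->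
  G @ \oo --> (0 : R) -> (fun k => G k `^ r) @ \oo --> (0 : R).
Proof.
move=> r0 G0 cG; apply/cvgrPdist_lt => e e0; near=> k.
rewrite sub0r normrN ger0_norm ?powR_ge0//.
have -> : e = (e `^ r^-1) `^ r by rewrite -powRrM mulVf ?gt_eqF// powRr1// ltW.
apply: gt0_ltr_powR => //; rewrite ?nnegrE ?powR_ge0//; first by near: k.
by near: k; have /cvgr_lt := cG; apply; rewrite powR_gt0.
Unshelve. all: by end_near.
Qed.

Lemma powRN_cvg0 s : 0 < s -> (fun k => (k%:R : R) `^ (- s)) @ \oo --> (0 : R).
Proof.
move=> s0; apply/cvgrPdist_lt => e e0; near=> k.
rewrite sub0r normrN ger0_norm ?powR_ge0//.
by near: k; exact: powRN_lt.
Unshelve. all: by end_near.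
Qed.

Variables (S X p a : nat -> R) (Ss lam tau gam alo ahi Cu : R).
Let q := 3 * gam - 1.
Let u k := Cu * k%:R `^ (- q).
Let G k := S k - Ss + tau * lam / 2 * X k ^+ 2 + u k.
Hypotheses (lam0 : 0 < lam) (tau0 : 0 < tau) (gam2 : 2^-1 < gam)
  (alo0 : 0 < alo) (Cu0 : 0 <= Cu)
  (ha : \forall k \near \oo, alo * k%:R `^ (- gam) <= a k <= ahi * k%:R `^ (- gam))
  (X0 : forall k, 0 <= X k) (p0 : forall k, 0 <= p k)
  (Gstep : \forall k \near \oo,
     G k.+1 <= G k - tau * a k / 8 * X k ^+ 2 - p k ^+ 2 / (8 * a k))
  (XG : \forall k \near \oo, tau * lam / 4 * X k ^+ 2 <= G k)
  (cG : G @ \oo --> (0 : R)).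

Let q0 : 0 < q. Proof. have := gam2; rewrite /q; lra. Qed.

Let u0 k : 0 <= u k. Proof. by rewrite mulr_ge0 ?powR_ge0. Qed.

Let apos : \forall k \near \oo, 0 < a k.
Proof.
near=> k.
have k0 : (0 < k)%N by near: k; exact: near_lt0n.
have /andP[ak _] : alo * k%:R `^ (- gam) <= a k <= ahi * k%:R `^ (- gam) by near: k.
by apply: lt_le_trans ak; rewrite mulr_gt0// powR_gt0// ltr0n.
Unshelve. all: by end_near.
Qed.

Let ahi0 : 0 <= ahi.
Proof.
have [K0 _ HK0] := ha.
have /andP[H1 H2] := HK0 (maxn K0 1) (leq_maxl _ _).
have x0 : 0 < (maxn K0 1)%:R `^ (- gam) :> R by rewrite powR_gt0// ltr0n leq_maxr.
by rewrite -(pmulr_lge0 _ x0) (le_trans _ H2)// (le_trans _ H1)// mulr_ge0// ltW.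
Qed.

Lemma merit_ge0 : \forall k \near \oo, 0 <= G k.
Proof.
near=> k.
have : tau * lam / 4 * X k ^+ 2 <= G k by near: k.
by apply: le_trans; rewrite mulr_ge0 ?sqr_ge0// divr_ge0// mulr_ge0 ?ltW.
Unshelve. all: by end_near.
Qed.

Lemma merit_decreasing : \forall k \near \oo, G k.+1 <= G k.
Proof.
near=> k.
have ak : 0 < a k by near: k; exact: apos.
have : G k.+1 <= G k - tau * a k / 8 * X k ^+ 2 - p k ^+ 2 / (8 * a k) by near: k.
have : 0 <= tau * a k / 8 * X k ^+ 2.
  by rewrite mulr_ge0 ?sqr_ge0// divr_ge0// mulr_ge0 ?ltW.
have : 0 <= p k ^+ 2 / (8 * a k) by rewrite divr_ge0 ?sqr_ge0// mulr_ge0// ltW.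
lra.
Unshelve. all: by end_near.
Qed.

Let X1 : \forall k \near \oo, X k <= 1.
Proof.
have tl0 : 0 < tau * lam / 4 by rewrite divr_gt0 ?mulr_gt0.
near=> k.
have : tau * lam / 4 * X k ^+ 2 <= G k by near: k.
have Gk : G k < tau * lam / 4.
  by near: k; have /cvgr_lt := cG; exact.
move=> H; have : X k ^+ 2 <= 1.
  by rewrite -(ler_pM2l tl0) mulr1 (le_trans H)// ltW.
by rewrite expr_le1.
Unshelve. all: by end_near.
Qed.

(** The condition 1 < gam + th q makes the errors a u^th of [KL_step] summable, and the second term
    of Z is their tail. The conclusion is conditional on the KL inequality at index k because that
    inequality is only known close to a cluster point. *)
Lemma KL_path c th : 0 < th < 1 -> 1 <= 2 * th -> 1 < gam + th * q -> 0 <= c ->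
  exists C2 C4, let Z := fun k =>
      C2 * G k `^ (1 - th) + C4 * k%:R `^ (- (gam + th * q - 1)) in
    [/\ 0 <= C2, 0 <= C4, \forall k \near \oo, 0 <= Z k, Z @ \oo --> (0 : R) &
    \forall k \near \oo, `|S k - Ss| `^ th <= c * X k -> p k <= Z k - Z k.+1].
Proof.
move=> th01 th2 gq c0; have /andP[th0 th1] := th01.
set s := gam + th * q - 1.
have s0 : 0 < s by rewrite subr_gt0.
pose C2 := 4 * ((3 * (c + (tau * lam / 2) `^ th) + 3) / (1 - th)) * (1 + tau^-1).
pose C4 := ahi * Cu `^ th / (s * 2 `^ (- s - 1)).
have C20 : 0 <= C2.
  apply: mulr_ge0; last by rewrite addr_ge0// invr_ge0 ltW.
  apply: mulr_ge0 => //; apply: divr_ge0; last by rewrite subr_ge0 ltW.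
  by have := powR_ge0 (tau * lam / 2) th; lra.
have C40 : 0 <= C4.
  by rewrite divr_ge0 ?mulr_ge0 ?powR_ge0 ?(ltW s0).
exists C2, C4; split => //=.
- by apply: nearW => k; rewrite addr_ge0 ?(mulr_ge0 C20) ?(mulr_ge0 C40) ?powR_ge0.
- rewrite -[0](_ : C2 * 0 + C4 * 0 = 0); last by rewrite !mulr0 addr0.
  apply: cvgD; apply: cvgMr; last exact: powRN_cvg0.
  apply: powR_seq_cvg0 => //; first by rewrite subr_gt0.
  exact: merit_ge0.
near=> k => KL.
have k0 : (0 < k)%N by near: k; exact: near_lt0n.
have G0 : 0 <= G k.+1 by near: k; exact: (near_succ merit_ge0).
have ak0 : 0 < a k by near: k; exact: apos.
have /andP[_ ak] : alo * k%:R `^ (- gam) <= a k <= ahi * k%:R `^ (- gam) by near: k.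
have Xk1 : X k <= 1 by near: k; exact: X1.
have step : G k.+1 <= G k - tau * a k / 8 * X k ^+ 2 - p k ^+ 2 / (8 * a k).
  by near: k.
have GS : G k <= `|S k - Ss| + (tau * lam / 2) * X k ^+ 2 + u k.
  by rewrite /G lerD2r lerD2r ler_norm.
have := KL_step th01 th2 ak0 tau0 c0 _ (u0 k) (p0 k) _ G0 (normr_ge0 _) GS KL step.
rewrite -/C2 X0 Xk1 => /(_ _ isT) H; apply: le_trans (H _) _.
  by rewrite divr_ge0 ?mulr_ge0 ?ltW.
have {}H : a k * u k `^ th <= C4 * (k%:R `^ (- s) - k.+1%:R `^ (- s)).
  have /andP[+ _] := powRN_step s0 k0.
  move=> /(ler_wpM2l C40); apply: le_trans.
  apply: (@le_trans _ _ (ahi * k%:R `^ (- gam) * u k `^ th)).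
    by rewrite ler_wpM2r ?powR_ge0.
  rewrite /u powRM ?powR_ge0// -powRrM.
  have -> : k%:R `^ (- s - 1) = k%:R `^ (- gam) * k%:R `^ (- q * th) :> R.
    rewrite -powRD; last by rewrite pnatr_eq0 -lt0n k0 implybT.
    by congr powR; rewrite /s; ring.
  rewrite [leRHS](_ : _ = ahi * k%:R `^ (- gam) * (Cu `^ th * k%:R `^ (- q * th)))//.
  by rewrite /C4; field; rewrite !gt_eqF ?powR_gt0.
by apply: le_trans (lerD (lexx _) H) _; rewrite !mulrBr [- (C2 * _ + _)]opprD addrACA.
Unshelve. all: by end_near.
Qed.

(** The equation on r is the balance gam + r (2 th) = r + 1 of [rate_superlinear], and r <= q keeps
    the error a u^(2 th) within order k^(-r - 1). *)
Lemma KL_rate_superlinear c th r : 2^-1 < th < 1 -> 0 <= c -> 0 < r -> r <= q ->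
  r * (2 * th - 1) = 1 - gam ->
  (\forall k \near \oo, `|S k - Ss| `^ th <= c * X k) ->
  exists M, \forall k \near \oo, G k <= M * k%:R `^ (- r).
Proof.
move=> /andP[th2 th1] c0 r0 rq rE KL.
have th0 : 0 < th by lra.
have th01 : 0 < th < 1 by rewrite th0.
have th2' : 1 <= 2 * th by lra.
pose B := 3 * (c + (tau * lam / 2) `^ th) + 3.
have B0 : 0 < B.
  by have := powR_ge0 (tau * lam / 2) th; rewrite /B; lra.
(* From the decrease tau a / 8 X^2 and X^2 >= G^(2 th) / (2 B^2) - U^2. *)
pose c1 := tau * alo / 16 / B ^+ 2.
apply: (@rate_superlinear _ G c1 (tau * ahi / 8 * Cu `^ (2 * th)) gam (2 * th) r) => //.
- by rewrite !(divr_gt0, mulr_gt0)// exprn_gt0.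
- by lra.
- by lra.
- exact: merit_decreasing.
near=> k.
have k0 : (0 < k)%N by near: k; exact: near_lt0n.
have k1 : 1 <= k%:R :> R by rewrite ler1n.
have G0 : 0 <= G k by near: k; exact: merit_ge0.
have ak0 : 0 < a k by near: k; exact: apos.
have /andP[ak1 ak2] : alo * k%:R `^ (- gam) <= a k <= ahi * k%:R `^ (- gam) by near: k.
have Xk1 : X k <= 1 by near: k; exact: X1.
have step : G k.+1 <= G k - tau * a k / 8 * X k ^+ 2 - p k ^+ 2 / (8 * a k).
  by near: k.
have p20 : 0 <= p k ^+ 2 / (8 * a k) by rewrite divr_ge0 ?sqr_ge0// mulr_ge0// ltW.
have GS : G k <= `|S k - Ss| + (tau * lam / 2) * X k ^+ 2 + u k.
  by rewrite /G lerD2r lerD2r ler_norm.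
have KLk : `|S k - Ss| `^ th <= c * X k by near: k.
have := KL_bound th01 th2' c0 _ (u0 k) _ G0 (normr_ge0 _) GS KLk.
rewrite X0 Xk1 -/B => /(_ _ isT) H.
have {}H : G k `^ th <= B * (X k + u k `^ th).
  by apply: H; rewrite divr_ge0 ?mulr_ge0 ?ltW.
set U := u k `^ th in H.
have GE : G k `^ (2 * th) = (G k `^ th) ^+ 2.
  by rewrite mulrC powRrM powR_mulrn// powR_ge0.
have UE : U ^+ 2 = Cu `^ (2 * th) * k%:R `^ (- (q * (2 * th))).
  rewrite /U -(powR_mulrn 2 (powR_ge0 _ _)) -powRrM mulrC /u powRM ?powR_ge0//.
  by rewrite -powRrM mulNr.
split=> //.
have G2 : G k `^ (2 * th) / (2 * B ^+ 2) - U ^+ 2 <= X k ^+ 2.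
  have : G k `^ (2 * th) <= 2 * B ^+ 2 * (X k ^+ 2 + U ^+ 2).
    rewrite GE; apply: (@le_trans _ _ ((B * (X k + U)) ^+ 2)).
      by rewrite lerXn2r ?nnegrE ?powR_ge0// (le_trans _ H)// powR_ge0.
    rewrite exprMn [2 * _]mulrC -[_ * 2 * _]mulrA ler_wpM2l ?sqr_ge0//.
    by have := sqr_ge0 (X k - U); lra.
  rewrite -ler_pdivrMl ?mulr_gt0 ?exprn_gt0//.
  rewrite [_^-1 * _]mulrC; lra.
have E1 : tau * a k / 8 * (G k `^ (2 * th) / (2 * B ^+ 2)) >= c1 * k%:R `^ (- gam) * G k `^ (2 * th).
  have -> : c1 * k%:R `^ (- gam) * G k `^ (2 * th) =
     alo * k%:R `^ (- gam) * (tau / 8 * (G k `^ (2 * th) / (2 * B ^+ 2))).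
    by rewrite /c1; field; rewrite gt_eqF.
  have -> : tau * a k / 8 * (G k `^ (2 * th) / (2 * B ^+ 2)) =
     a k * (tau / 8 * (G k `^ (2 * th) / (2 * B ^+ 2))) by ring.
  rewrite ler_wpM2r// mulr_ge0 ?divr_ge0 ?powR_ge0 ?(ltW tau0)// mulr_ge0// sqr_ge0//.
have E2 : tau * a k / 8 * U ^+ 2 <= tau * ahi / 8 * Cu `^ (2 * th) * k%:R `^ (- r - 1).
  rewrite UE.
  apply: (@le_trans _ _ (tau / 8 * Cu `^ (2 * th) * (ahi * k%:R `^ (- gam) * k%:R `^ (- (q * (2 * th)))))).
    rewrite [leLHS](_ : _ = tau / 8 * Cu `^ (2 * th) * (a k * k%:R `^ (- (q * (2 * th))))); last by ring.
    rewrite ler_wpM2l ?ler_wpM2r ?mulr_ge0 ?powR_ge0 ?divr_ge0 ?(ltW tau0)//.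
  rewrite [leRHS](_ : _ = tau / 8 * Cu `^ (2 * th) * (ahi * k%:R `^ (- r - 1))); last by ring.
  rewrite ler_wpM2l ?mulr_ge0 ?powR_ge0 ?divr_ge0 ?(ltW tau0)// -mulrA ler_wpM2l//.
  rewrite -powRD; last by rewrite pnatr_eq0 -lt0n k0 implybT.
  apply: ler_powR => //.
  have : r * (2 * th) <= q * (2 * th) by rewrite ler_wpM2r// mulr_ge0// ltW.
  lra.
have ta0 : 0 <= tau * a k / 8 by rewrite divr_ge0 ?mulr_ge0 ?ltW.
have := ler_wpM2l ta0 G2; rewrite mulrBr; lra.
Unshelve. all: by end_near.
Qed.

(** At th = 1/2 the KL inequality can be squared, giving G - u <= (c^2 + tau lam / 2) X^2. This
    avoids the lossy constant of [KL_bound], which would spoil the explicit condition on the step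
    size. *)
Lemma KL_rate_linear c Q : gam = 1 -> 2 < Q -> 0 <= c ->
  (\forall k \near \oo, (c ^+ 2 + tau * lam / 2) * (Q * k%:R^-1) <= tau * a k / 8) ->
  (\forall k \near \oo, `|S k - Ss| `^ 2^-1 <= c * X k) ->
  exists M, \forall k \near \oo, G k <= M * k%:R `^ (- 2).
Proof.
move=> gE Q2 c0 haQ KL.
apply: (@rate_linear _ G Q (Q * Cu)) => //; first exact: merit_decreasing.
near=> k.
have k0 : (0 < k)%N by near: k; exact: near_lt0n.
have G0 : 0 <= G k by near: k; exact: merit_ge0.
have ak0 : 0 < a k by near: k; exact: apos.
have step : G k.+1 <= G k - tau * a k / 8 * X k ^+ 2 - p k ^+ 2 / (8 * a k).
  by near: k.
have p20 : 0 <= p k ^+ 2 / (8 * a k) by rewrite divr_ge0 ?sqr_ge0// mulr_ge0// ltW.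
have akQ : (c ^+ 2 + tau * lam / 2) * (Q * k%:R^-1) <= tau * a k / 8 by near: k.
have KLk : `|S k - Ss| `^ 2^-1 <= c * X k by near: k.
have S2 : `|S k - Ss| <= c ^+ 2 * X k ^+ 2.
  rewrite -exprMn -[leLHS]sqr_sqrtr// -powR12_sqrt//.
  by rewrite lerXn2r ?nnegrE ?powR_ge0// mulr_ge0.
split=> //.
have SN := ler_norm (S k - Ss).
have GX : G k - u k <= (c ^+ 2 + tau * lam / 2) * X k ^+ 2 by rewrite /G; lra.
(* gam = 1 gives q = 2, so the error is Q / k times [u k]. *)
have uE : Q * Cu * k%:R `^ (- 2 - 1) = Q * k%:R^-1 * u k.
  have -> : k%:R `^ (- 2 - 1) = k%:R `^ (-1) * k%:R `^ (- q) :> R.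
    rewrite -powRD; last by rewrite pnatr_eq0 -lt0n k0 implybT.
    by congr powR; rewrite /q gE; ring.
  by rewrite powR_inv1// /u; ring.
rewrite uE.
have Qk : 0 <= Q * k%:R^-1 by rewrite mulr_ge0 ?invr_ge0//; lra.
have := ler_wpM2l Qk GX.
have := ler_wpM2r (sqr_ge0 (X k)) akQ.
rewrite mulrBr; lra.
Unshelve. all: by end_near.
Qed.

(** The inequality on r (1 - th) says that the tail term decays no slower than the bound for G^(1 -
    th). *)
Lemma path_rate C2 C4 th r M : 0 < th < 1 -> 0 <= C2 -> 0 <= C4 -> 0 < r ->
  r * (1 - th) <= gam + th * q - 1 ->
  (\forall k \near \oo, G k <= M * k%:R `^ (- r)) ->
  exists M', \forall k \near \oo,
   C2 * G k `^ (1 - th) + C4 * k%:R `^ (- (gam + th * q - 1)) <=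
   M' * k%:R `^ (- (r * (1 - th))).
Proof.
move=> /andP[th0 th1] C20 C40 r0 rs HM.
exists (C2 * `|M| `^ (1 - th) + C4); near=> k.
have k0 : (0 < k)%N by near: k; exact: near_lt0n.
have k1 : 1 <= k%:R :> R by rewrite ler1n.
have G0 : 0 <= G k by near: k; exact: merit_ge0.
have GM : G k <= M * k%:R `^ (- r) by near: k.
rewrite mulrDl lerD//; last by rewrite ler_wpM2l// ler_powR// lerN2.
rewrite -mulrA ler_wpM2l// -mulNr powRrM -powRM ?powR_ge0//.
apply: ge0_ler_powR; rewrite ?nnegrE ?mulr_ge0 ?powR_ge0 ?subr_ge0 ?(ltW th1)//.
by apply: le_trans GM _; rewrite ler_wpM2r ?powR_ge0// ler_norm.
Unshelve. all: by end_near.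
Qed.

End KLPath.


(** * Euclidean geometry and smooth functions *)

Section Euclidean.
Variables (R : realType) (d : nat).
Implicit Types (u v w x y : 'rV[R]_d) (a b : R).

Lemma dotrC u v : dotr u v = dotr v u.
Proof. by apply: eq_bigr => j _; rewrite mulrC. Qed.

Lemma dotrDl u v w : dotr (u + v) w = dotr u w + dotr v w.
Proof. by rewrite -big_split; apply: eq_bigr => j _; rewrite mxE mulrDl. Qed.

Lemma dotrZl a u v : dotr (a *: u) v = a * dotr u v.
Proof. by rewrite [RHS]mulr_sumr; apply: eq_bigr => j _; rewrite mxE mulrA. Qed.

Lemma dotrDr u v w : dotr w (u + v) = dotr w u + dotr w v.
Proof. by rewrite dotrC dotrDl !(dotrC w). Qed.

Lemma dotrZr a u v : dotr u (a *: v) = a * dotr u v.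
Proof. by rewrite dotrC dotrZl dotrC. Qed.

Lemma dotrNl u v : dotr (- u) v = - dotr u v.
Proof. by rewrite -scaleN1r dotrZl mulN1r. Qed.

Lemma dotrNr u v : dotr u (- v) = - dotr u v.
Proof. by rewrite -scaleN1r dotrZr mulN1r. Qed.

Definition dotrE := (dotrDl, dotrDr, dotrNl, dotrNr, dotrZl, dotrZr).

Lemma dotr_suml (I : finType) (F : I -> 'rV[R]_d) v :
  dotr (\sum_i F i) v = \sum_i dotr (F i) v.
Proof.
rewrite /dotr exchange_big/=; apply: eq_bigr => j _.
by rewrite summxE mulr_suml.
Qed.

Lemma dotr_ge0 u : 0 <= dotr u u.
Proof. by apply: sumr_ge0 => j _; rewrite -expr2 sqr_ge0. Qed.

Lemma enorm_ge0 u : 0 <= enorm u.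
Proof. exact: sqrtr_ge0. Qed.

Lemma enorm_sqr u : enorm u ^+ 2 = dotr u u.
Proof. by rewrite sqr_sqrtr// dotr_ge0. Qed.

Lemma dotr_eq0 u : dotr u u = 0 -> u = 0.
Proof.
move=> /eqP; rewrite psumr_eq0 => [/allP H|j _]; last by rewrite -expr2 sqr_ge0.
apply/rowP => j; rewrite mxE; apply/eqP.
by have := H j (mem_index_enum _); rewrite mulf_eq0 orbb.
Qed.

(** Cauchy-Schwarz, by expanding the squared norm of <v, v> u - <u, v> v. *)
Lemma dotr_le u v : dotr u v <= enorm u * enorm v.
Proof.
have [v0|v0] := eqVneq (dotr v v) 0.
  by rewrite (dotr_eq0 v0) -(scale0r 0) dotrZr mul0r mulr_ge0// enorm_ge0.
have vv : 0 < dotr v v by rewrite lt_neqAle eq_sym v0 dotr_ge0.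
have [uv|uv] := leP (dotr u v) 0.
  by apply: le_trans uv _; rewrite mulr_ge0// enorm_ge0.
rewrite -(@ler_pXn2r _ 2) ?nnegrE ?mulr_ge0 ?enorm_ge0 ?(ltW uv)//.
rewrite exprMn !enorm_sqr -(ler_pM2l vv).
have := dotr_ge0 (dotr v v *: u - dotr u v *: v).
rewrite !dotrE (dotrC v u); nra.
Qed.

Lemma dotr_ge u v : - (enorm u * enorm v) <= dotr u v.
Proof.
by rewrite lerNl -dotrNl (le_trans (dotr_le _ _))// /enorm !dotrE opprK.
Qed.

Lemma enormZ a u : enorm (a *: u) = `|a| * enorm u.
Proof. by rewrite /enorm !dotrE mulrA -expr2 sqrtrM ?sqr_ge0// sqrtr_sqr. Qed.

Lemma enormN u : enorm (- u) = enorm u.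
Proof. by rewrite -scaleN1r enormZ normrN1 mul1r. Qed.

Lemma enorm0 : enorm (0 : 'rV[R]_d) = 0.
Proof. by rewrite -(scale0r 0) enormZ normr0 mul0r. Qed.

Lemma enormC u v : enorm (u - v) = enorm (v - u).
Proof. by rewrite -enormN opprB. Qed.

Lemma ler_enormD u v : enorm (u + v) <= enorm u + enorm v.
Proof.
rewrite -(@ler_pXn2r _ 2) ?nnegrE ?addr_ge0 ?enorm_ge0//.
rewrite sqrrD !enorm_sqr !dotrE (dotrC v u); have := dotr_le u v; lra.
Qed.

Lemma ler_enormB u v : enorm (u - v) <= enorm u + enorm v.
Proof. by rewrite -(enormN v) ler_enormD. Qed.

Lemma ler_enorm_dist x y w : enorm (x - y) <= enorm (x - w) + enorm (w - y).
Proof. by rewrite -[x - y](subrKA w) ler_enormD. Qed.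

Lemma ler_dist_enorm u v : `|enorm u - enorm v| <= enorm (u - v).
Proof.
have := ler_enormD (u - v) v; have := ler_enormD (v - u) u.
by rewrite !subrK (enormC v u) ler_norml; lra.
Qed.

Lemma ler_enorm_sum (I : finType) (F : I -> 'rV[R]_d) :
  enorm (\sum_i F i) <= \sum_i enorm (F i).
Proof.
elim/big_ind2 : _ => [|x a y b xa yb|//]; first by rewrite enorm0.
by rewrite (le_trans (ler_enormD _ _))// lerD.
Qed.

(** Neighbourhoods and limits refer to the sup norm; this bound and the next one transfer them to
    the Euclidean norm. *)
Lemma norm_le_enorm u : `|u| <= enorm u.
Proof.
rewrite [leLHS]/Num.Def.normr/= mx_normrE; apply/bigmax_leP; split; first exact: enorm_ge0.
move=> [i j] _ /=; rewrite ord1 -(@ler_pXn2r _ 2) ?nnegrE ?enorm_ge0//.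
rewrite enorm_sqr /dotr (bigD1 j)//= real_normK ?num_real// expr2 lerDl.
by apply: sumr_ge0 => l _; rewrite -expr2 sqr_ge0.
Qed.

Lemma enorm_le_norm u : enorm u <= d%:R * `|u|.
Proof.
rewrite -(@ler_pXn2r _ 2) ?nnegrE ?enorm_ge0 ?mulr_ge0// enorm_sqr exprMn.
have H j : u 0 j * u 0 j <= `|u| ^+ 2.
  rewrite -expr2 -(real_normK (num_real (u 0 j))) lerXn2r ?nnegrE//.
  rewrite [leRHS]/Num.Def.normr/= mx_normrE.
  by apply: (@le_bigmax _ _ _ 0 (fun ij : 'I_1 * 'I_d => `|u ij.1 ij.2|) (0, j)).
apply: le_trans (ler_sum _ (fun j _ => H j)) _.
rewrite sumr_const card_ord -[leLHS]mulr_natl ler_wpM2r ?sqr_ge0//.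
by rewrite expr2 -natrM ler_nat; case: (d) => // m; rewrite leq_pmulr.
Qed.

Lemma near_enorm_lt x (e : R) : 0 < e -> \forall y \near x, enorm (y - x) < e.
Proof.
(* Dividing by [d.+1] rather than by [d] keeps the radius positive when d = 0. *)
move=> e0; have d0 : 0 < d.+1%:R :> R by rewrite ltr0n.
apply/nbhs_normP; exists (e / d.+1%:R); first by rewrite /= divr_gt0.
move=> y /=; rewrite distrC ltr_pdivlMr// mulrC => H.
apply: le_lt_trans H; apply: le_trans (enorm_le_norm _) _.
by rewrite ler_wpM2r// ler_nat.
Qed.

Lemma near_enormP x (P : 'rV[R]_d -> Prop) : (\forall y \near x, P y) ->
  exists2 e : R, 0 < e & forall y, enorm (y - x) < e -> P y.
Proof.
move=> /nbhs_normP[e /= e0 H]; exists e => // y ye; apply: H => /=.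
by rewrite distrC; apply: le_lt_trans (norm_le_enorm _) ye.
Qed.

Lemma grad_diff (g : 'rV[R]_d -> R) x v : differentiable g x ->
  'd g x v = dotr (grad g x) v.
Proof.
move=> dg; rewrite {1}(row_sum_delta v) linear_sum; apply: eq_bigr => j _.
by rewrite linearZ/= mxE -deriveE// mulrC.
Qed.

Lemma near_taylor1 (g : 'rV[R]_d -> R) x (e : R) : differentiable g x -> 0 < e ->
  \forall y \near x, `|g y - g x - dotr (grad g x) (y - x)| <= e * enorm (y - x).
Proof.
move=> dg e0; have /eqaddoP/(_ e e0) H := diff_locally dg.
rewrite (near_shift 0); apply: filterS H => h /=.
rewrite subr0 addrK -[X in `|X|]/(g (h + x) - (g x + 'd g x h)) grad_diff// opprD addrA.
by move=> H; apply: le_trans H _; rewrite ler_wpM2l ?(ltW e0)// norm_le_enorm.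
Qed.

Lemma is_derive_line (g : 'rV[R]_d -> R) x v (t : R) : differentiable g (x + t *: v) ->
  is_derive t 1 (fun s : R => g (x + s *: v)) (dotr (grad g (x + t *: v)) v).
Proof.
move=> dg.
have E : (fun h : R => h^-1 *: (((fun s : R => g (x + s *: v)) \o shift t) (h *: 1)
    - g (x + t *: v))) = fun h => h^-1 *: ((g \o shift (x + t *: v)) (h *: v) - g (x + t *: v)).
  apply/funext => h /=; congr (_ *: (g _ - _)).
  by rewrite scalerDl [_ *: 1]mulr1 addrCA.
have dv := diff_derivable (v := v) dg.
apply: DeriveDef; first by rewrite /derivable E.
by rewrite /derive E -[LHS]/('D_v g _) deriveE// grad_diff.
Qed.

(** The Lipschitz bound is asked only between x and points of the segment, since gradients are
    Lipschitz on [dom phi] alone. Along the segment, g minus its quadratic model has nonpositive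
    derivative, so the mean value theorem suffices. *)
Lemma descent_lemma (g : 'rV[R]_d -> R) (L : R) x y :
  (forall z, differentiable g z) ->
  (forall t : R, 0 <= t <= 1 -> enorm (grad g (x + t *: (y - x)) - grad g x) <=
     L * enorm (t *: (y - x))) ->
  g y <= g x + dotr (grad g x) (y - x) + L / 2 * enorm (y - x) ^+ 2.
Proof.
move=> dg lip; set v := y - x.
pose h (t : R) := g (x + t *: v) - (t * dotr (grad g x) v + t ^+ 2 * (L / 2 * enorm v ^+ 2)).
pose dh (t : R) := dotr (grad g (x + t *: v)) v -
  (dotr (grad g x) v + t * (L * enorm v ^+ 2)).
have hd (t : R) : is_derive t 1 h (dh t).
  apply: is_deriveB; first exact: is_derive_line.
  apply: is_deriveD.
    have := @is_deriveM R R id (cst (dotr (grad g x) v)) t 1 1 0 _ _.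
    rewrite /= scaler0 add0r [_ *: 1]mulr1; exact.
  have := @is_deriveM R R (fun t => t ^+ 2) (cst (L / 2 * enorm v ^+ 2)) t 1 (2 * t) 0 _ _.
  rewrite /= scaler0 add0r.
  have -> : (L / 2 * enorm v ^+ 2) *: (2 * t) = t * (L * enorm v ^+ 2).
    by rewrite /GRing.scale/=; field.
  apply.
    have := @is_deriveX R R id 2 t 1 1 (is_derive_id _ _).
    by rewrite /= expr1 [_ *: 1]mulr1; congr is_derive; apply/funext => s.
have [|c] := @MVT_segment R h dh 0 1 ler01 (fun (s : R) _ => hd s).
  apply: continuous_subspaceT => t.
  by apply/differentiable_continuous/derivable1_diffP; by case: (hd t).
rewrite in_itv/= => c01; have /andP[c0 c1] := c01.
rewrite /h scale0r addr0 scale1r !mul0r expr0n/= mul0r addr0 subr0 subr0 expr1n !mul1r mulr1.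
rewrite [x + v]addrC subrK.
suff : dh c <= 0 by lra.
rewrite /dh opprD addrA subr_le0 -dotrNl -dotrDl.
apply: le_trans (dotr_le _ _) _.
have := ler_wpM2r (enorm_ge0 v) (lip c c01).
by rewrite -/v enormZ ger0_norm//; lra.
Qed.

End Euclidean.


(* [X], [X'], [P], [E] are the norms of the residuals [F], [F'], the step [p] and
   the error [e]; [fp], [ep], [fe], [fG] are the inner products of [F], [e] with
   [p], [e] and the gradient increment [G]. *)
Lemma descent_scalar (R : realType) (a lam rho L t psi psi' X P E X' fp ep fe fG : R) :
  let b := 1 - a / lam in
  0 < a -> 0 < lam -> 0 < rho -> 0 < L -> 4 * (lam * rho) < 1 ->
  0 < t <= tauPRR rho L lam ->
  a <= lam / 4 -> a * (16 * (L + rho)) <= 1 -> a * (24 * (lam * L ^+ 2 + lam^-1)) <= 1 ->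
  0 <= X -> 0 <= P -> 0 <= E ->
  psi' <= psi + fp + (- a * fp + ep) / lam + ((L + rho) / 2 - lam^-1) * P ^+ 2 ->
  (1 - lam * rho) * P ^+ 2 <= - a * fp + ep ->
  X' ^+ 2 <= b ^+ 2 * X ^+ 2 + 2 * b * (fe / lam + fG - fp / lam) +
     3 * (E ^+ 2 / lam ^+ 2 + L ^+ 2 * P ^+ 2 + P ^+ 2 / lam ^+ 2) ->
  ep <= E * P -> fe <= X * E -> fG <= X * (L * P) ->
  psi' + t * lam / 2 * X' ^+ 2 <= psi + t * lam / 2 * X ^+ 2
    - t * a / 4 * X ^+ 2 - P ^+ 2 / (8 * a) + 8 * (E ^+ 2 / a).
Proof.
move=> b a0 l0 r0 L0 lr /andP[t0 tt] al aL aL2 X0 P0 E0 H1 H2 H3 Hep Hfe HfG.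
have lr0 : 0 < lam * rho by rewrite mulr_gt0.
have tden : 0 < 2 * (1 - 2 * (lam * rho) + lam ^+ 2 * L ^+ 2).
  by have := mulr_gt0 (exprn_gt0 2 l0) (exprn_gt0 2 L0); lra.
have tauD : t * (2 * (1 - 2 * (lam * rho) + lam ^+ 2 * L ^+ 2)) <= 1 - 4 * (lam * rho).
  rewrite -ler_pdivlMr//; apply: le_trans tt _.
  by rewrite /tauPRR !mulrA.
set m := lam ^+ 2 * L ^+ 2 in tden tauD.
have m0 : 0 < m by rewrite mulr_gt0 ?exprn_gt0.
have tm0 : 0 < t * m by rewrite mulr_gt0.
have t12 : t <= 2^-1 by clear - tm0 tauD t0 lr lr0 tden; nra.
have b34 : 3 / 4 <= b.
  have : a / lam <= 4^-1 by rewrite ler_pdivrMr// mulrC.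
  by rewrite /b; clear; lra.
have b1 : b <= 1 by rewrite /b gerBl divr_ge0 ?ltW.
have b0 : 0 <= b by clear - b34; lra.
set il := lam^-1 in b b34 b1 b0 H1 H3 aL2 *.
have il0 : 0 < il by rewrite invr_gt0.
have lil : lam * il = 1 by rewrite mulfV ?gt_eqF.
have bE : a * il = 1 - b by rewrite /b -/il; clear; lra.
(* Dividing P^2, E^2 and E P by [a] once turns what follows into bookkeeping in y, z, K and X^2. *)
have [y yE] : exists y, P ^+ 2 = a * y by exists (P ^+ 2 / a); rewrite mulrCA mulfV ?gt_eqF// mulr1.
have [z zE] : exists z, E ^+ 2 = a * z by exists (E ^+ 2 / a); rewrite mulrCA mulfV ?gt_eqF// mulr1.
have [K KE] : exists K, E * P = a * K by exists (E * P / a); rewrite mulrCA mulfV ?gt_eqF// mulr1.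
have y0 : 0 <= y by rewrite -(pmulr_rge0 _ a0) -yE sqr_ge0.
have z0 : 0 <= z by rewrite -(pmulr_rge0 _ a0) -zE sqr_ge0.
have K0 : 0 <= K by rewrite -(pmulr_rge0 _ a0) -KE mulr_ge0.
have PE : K <= y / 16 + 4 * z.
  rewrite -(ler_pM2l a0) -KE mulrDr.
  by have := sqr_ge0 (P - 8 * E); clear - yE zE KE; lra.
have tX0 : 0 <= t * X ^+ 2 by rewrite mulr_ge0 ?sqr_ge0// ltW.
have XE : X * E <= a * X ^+ 2 / 8 + 2 * z.
  rewrite -(ler_pM2l a0).
  by have := sqr_ge0 (a * X - 4 * E); clear - zE; lra.
have XP : lam * (X * (L * P)) <= a * X ^+ 2 / 2 + m / 2 * y.
  rewrite -(ler_pM2l a0).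
  have : lam ^+ 2 * L ^+ 2 * P ^+ 2 = m * (a * y) by rewrite -yE.
  by have := sqr_ge0 (a * X - lam * L * P); clear; lra.
(* Cocoercivity of the proximal map makes [fp] negative of order y, up to the error; this is the
   main source of decrease. *)
have fpK : fp <= K - (1 - lam * rho) * y.
  by rewrite -(ler_pM2l a0); move: H2; rewrite yE; clear - KE Hep; lra.
have t1 : 0 <= 1 - t by clear - t12; lra.
have A1 : b * (1 - t) * fp <= y / 16 + 4 * z - b * (1 - t) * (1 - lam * rho) * y.
  have bt0 : 0 <= b * (1 - t) by rewrite mulr_ge0.
  have bt1 : b * (1 - t) <= 1 by rewrite mulr_ile1// gerBl ltW.
  have := ler_wpM2l bt0 fpK; have := ler_wpM2r K0 bt1; clear - PE; lra.
have A2 : t * b * fe <= t * a * X ^+ 2 / 8 + z.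
  have tb0 : 0 <= t * b by rewrite mulr_ge0// ltW.
  have tb1 : t * b <= t by rewrite ler_piMr// ltW.
  have XE0 : 0 <= X * E by rewrite mulr_ge0.
  have := ler_wpM2l tb0 Hfe; have := ler_wpM2r XE0 tb1; have := ler_wpM2l (ltW t0) XE.
  have := ler_wpM2r z0 t12; clear; lra.
have A3 : t * lam * b * fG <= t * a * X ^+ 2 / 2 + b * t * m / 2 * y.
  have tb0 : 0 <= t * b by rewrite mulr_ge0// ltW.
  have tb1 : t * b <= t by rewrite ler_piMr// ltW.
  have aX0 : 0 <= a * X ^+ 2 / 2 by rewrite divr_ge0// mulr_ge0 ?sqr_ge0// ltW.
  have := ler_wpM2l tb0 (ler_wpM2l (ltW l0) HfG); have := ler_wpM2l tb0 XP.
  have := ler_wpM2r aX0 tb1; clear; lra.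
have A4 : il * ep <= y / 64 + z.
  have : il * ep <= il * (a * K) by rewrite ler_pM2l// -KE.
  have -> : il * (a * K) = (1 - b) * K by rewrite -bE; ring.
  have : (1 - b) * K <= 4^-1 * K by rewrite ler_wpM2r//; clear - b34; lra.
  clear - PE; lra.
have A5 : (L + rho) / 2 * (a * y) <= y / 32.
  by have := ler_wpM2r y0 aL; clear; lra.
have A6 : 0 <= il * (a * y) by rewrite mulr_ge0 ?(ltW il0)// mulr_ge0// ltW.
have A7 : t * lam / 2 * (b ^+ 2 * X ^+ 2) - t * lam / 2 * X ^+ 2 <= - (7 / 8 * (t * a * X ^+ 2)).
  have -> : t * lam / 2 * (b ^+ 2 * X ^+ 2) - t * lam / 2 * X ^+ 2 =
     - (t * X ^+ 2 * (lam * (1 - b) * ((1 + b) / 2))) by field.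
  have -> : lam * (1 - b) = a by rewrite -bE mulrCA lil mulr1.
  rewrite lerN2.
  have : a * (7 / 8) <= a * ((1 + b) / 2) by rewrite ler_pM2l//; clear - b34; lra.
  by move=> /(ler_wpM2l tX0); clear; lra.
have A8 : 3 * t / 2 * (il * (a * z)) <= z.
  have -> : 3 * t / 2 * (il * (a * z)) = (3 / 2 * t * (1 - b)) * z by rewrite -bE; ring.
  rewrite ler_piMl// (@le_trans _ _ (3 / 2 * t))//; last by clear - t12; lra.
  by rewrite ler_piMr ?mulr_ge0 ?gerBl// ltW.
have A9 : 3 * t / 2 * ((lam * L ^+ 2 + il) * (a * y)) <= y / 32.
  have h : (lam * L ^+ 2 + il) * (a * y) <= y / 24.
    by have := ler_wpM2r y0 aL2; clear; lra.
  have t32 : 0 <= 3 * t / 2 by clear - t0; lra.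
  have := ler_wpM2l t32 h; have := ler_wpM2r y0 t12; clear; lra.
(* The formula of [tauPRR] serves this bound: for t <= tau the bracket is at least 1/2. *)
have A10 : b / 2 * y <= b * ((1 - t) * (1 - lam * rho) - t * m / 2) * y.
  rewrite ler_wpM2r// ler_wpM2l//.
  have : t * (lam * rho) <= 2^-1 * (lam * rho) by rewrite ler_wpM2r// ltW.
  clear - tauD lr0 tm0; lra.
have A11 : 3 / 8 * y <= b / 2 * y by rewrite ler_wpM2r//; clear - b34; lra.
have T3 : t * lam / 2 * X' ^+ 2 <= t * lam / 2 * (b ^+ 2 * X ^+ 2) + t * b * fe
    + t * lam * b * fG - t * b * fp + 3 * t / 2 * (il * (a * z))
    + 3 * t / 2 * ((lam * L ^+ 2 + il) * (a * y)).
  have tl0 : 0 <= t * lam / 2 by rewrite divr_ge0// mulr_ge0// ltW.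
  apply: le_trans (ler_wpM2l tl0 H3) _.
  rewrite yE zE -!exprVn -/il.
  have -> : t * lam / 2 * (b ^+ 2 * X ^+ 2 + 2 * b * (fe * il + fG - fp * il) +
     3 * (a * z * il ^+ 2 + L ^+ 2 * (a * y) + a * y * il ^+ 2)) =
     t * lam / 2 * (b ^+ 2 * X ^+ 2) + lam * il * (t * b * fe)
    + t * lam * b * fG - lam * il * (t * b * fp) + lam * il * (3 * t / 2 * (il * (a * z)))
    + 3 * t / 2 * ((lam * L ^+ 2 + lam * il * il) * (a * y)) by field.
  by rewrite lil !mul1r.
have -> : P ^+ 2 / (8 * a) = y / 8 by rewrite yE; field; rewrite gt_eqF.
have -> : E ^+ 2 / a = z by rewrite zE mulrAC mulfV ?gt_eqF// mul1r.
have H1' : psi' <= psi + b * fp + il * ep + (L + rho) / 2 * (a * y) - il * (a * y).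
  apply: le_trans H1 _; rewrite yE /b -/il; clear; lra.
(* The coefficients of t a X^2 add up to -7/8 + 1/8 + 1/2 = -1/4, and those of z to 4 + 1 + 1 + 1 <=
   8. The gain 3/8 y exceeds 1/16 + 1/64 + 1/32 + 1/32 plus the 1/8 that is kept. *)
clear - H1' T3 A1 A2 A3 A4 A5 A6 A7 A8 A9 A10 A11 z0 y0; lra.
Qed.


(** Let t tend to 0; this extracts a first-order inequality from minimality along a segment. *)
Lemma affine_ge0 (R : realType) (A B : R) :
  (forall t, 0 < t <= 1 -> 0 <= A + t * B) -> 0 <= A.
Proof.
move=> H; apply/ler_addgt0Pr => e e0.
have B0 : 0 < `|B| + 1 by rewrite ltr_wpDl.
pose t := Num.min 1 (e / (`|B| + 1)).
have t0 : 0 < t by rewrite lt_min ltr01 divr_gt0.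
have tB : t * B <= e.
  apply: (@le_trans _ _ (t * (`|B| + 1))).
    by rewrite ler_wpM2l ?(ltW t0)// (le_trans (ler_norm _))// lerDl.
  by rewrite -ler_pdivlMr// ge_min lexx orbT.
have := H t; rewrite t0 ge_min lexx => /(_ isT) ?; lra.
Qed.

(** * Weakly convex functions, proximal maps and the composite objective *)

Section WeaklyConvex.
Variables (R : realType) (d : nat) (phi : 'rV[R]_d -> \bar R) (rho : R).
Hypotheses (phi_wconvex : weakly_convex rho phi) (phi_proper : proper phi).
Implicit Types (x y z w : 'rV[R]_d) (lambda : R).

Let phr x : R := fine (phi x).

Lemma dom_fine x : dom phi x -> phi x = (fine (phi x))%:E.
Proof.
move=> dx; rewrite fineK// fin_numE; have [/(_ x) px _] := phi_proper.
by rewrite gt_eqF// lt_eqF.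
Qed.

Lemma weakly_convex_fine x y (t : R) : dom phi x -> dom phi y -> 0 <= t <= 1 ->
  dom phi (t *: x + (1 - t) *: y) /\
  phr (t *: x + (1 - t) *: y) <=
    t * phr x + (1 - t) * phr y + rho / 2 * (t * (1 - t)) * enorm (x - y) ^+ 2.
Proof.
move=> dx dy t01; have /andP[t0 t1] := t01.
have := @phi_wconvex x y t t01; set v := t *: x + (1 - t) *: y.
rewrite /= (dom_fine dx) (dom_fine dy) -!EFinD => H.
have dv : dom phi v.
  rewrite /dom/=; case E : (phi v) => [r| |]; rewrite ?ltry ?ltNyr//.
  by move: H; rewrite E.
split=> //; move: H; rewrite (dom_fine dv) -EFinD lee_fin -!/(phr _) => H.
have : enorm v ^+ 2 = t * enorm x ^+ 2 + (1 - t) * enorm y ^+ 2 -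
    t * (1 - t) * enorm (x - y) ^+ 2.
  by rewrite !enorm_sqr /v !dotrE (dotrC y x); ring.
move=> vE; rewrite vE in H; lra.
Qed.

Lemma prox_dom lambda z w : prox lambda phi z w -> dom phi w.
Proof.
move=> H; have [_ [y dy]] := phi_proper.
have := H y; rewrite (dom_fine dy) -EFinD /dom/=.
by case: (phi w) => [r| |] //=; rewrite ltry.
Qed.

(** (z - w) / lambda is a subgradient of [phi] at w with quadratic slack: compare w with t y + (1 -
    t) w in the minimization, divide by t and let t tend to 0. *)
Lemma prox_ineq lambda z w y : 0 < lambda -> prox lambda phi z w -> dom phi y ->
  phr w + lambda^-1 * dotr (z - w) (y - w) - rho / 2 * enorm (y - w) ^+ 2 <= phr y.
Proof.
move=> l0 pw dy; have dw := prox_dom pw.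
set D := dotr (z - w) (y - w); set N := enorm (y - w) ^+ 2.
suff : 0 <= (phr y - phr w + rho / 2 * N - lambda^-1 * D) by lra.
apply: (@affine_ge0 _ _ ((2 * lambda)^-1 * N - rho / 2 * N)) => t /andP[t0 t1].
have t01 : 0 <= t <= 1 by rewrite ltW.
have [dv vle] := weakly_convex_fine dy dw t01.
have := pw (t *: y + (1 - t) *: w).
rewrite (dom_fine dw) (dom_fine dv) -!EFinD lee_fin -!/(phr _) => H.
have E : enorm (z - (t *: y + (1 - t) *: w)) ^+ 2 =
    enorm (z - w) ^+ 2 - 2 * t * D + t ^+ 2 * N.
  by rewrite !enorm_sqr /D /N enorm_sqr !dotrE (dotrC y w) (dotrC y z) (dotrC w z); ring.
rewrite E in H.
rewrite -(pmulr_rge0 _ t0) -/N in vle *.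
have il : lambda^-1 = 2 * (2 * lambda)^-1 by field; rewrite gt_eqF.
rewrite il; lra.
Qed.

(** Add [prox_ineq] at w tested with w' and at w' tested with w; each costs rho / 2 |w' - w|^2. *)
Lemma prox_cocoercive lambda z w z' w' : 0 < lambda ->
  prox lambda phi z w -> prox lambda phi z' w' ->
  (1 - lambda * rho) * enorm (w' - w) ^+ 2 <= dotr (z' - z) (w' - w).
Proof.
move=> l0 pw pw'.
have := prox_ineq l0 pw (prox_dom pw').
have := prox_ineq l0 pw' (prox_dom pw).
set N := enorm (w' - w) ^+ 2; rewrite enormC -/N.
have -> : dotr (z' - z) (w' - w) = dotr (z - w) (w' - w) * (-1) - dotr (z' - w') (w - w') + N.
  by rewrite /N enorm_sqr !dotrE (dotrC w' w) ; ring.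
set A := dotr (z' - w') _; set B := dotr (z - w) _ => H1 H2.
have il : 0 < lambda^-1 by rewrite invr_gt0.
rewrite -(ler_pM2l il).
have -> : lambda^-1 * ((1 - lambda * rho) * N) = lambda^-1 * N - rho * N.
  by field; rewrite gt_eqF.
lra.
Qed.

Lemma prox_lipschitz lambda z w z' w' : 0 < lambda -> lambda * rho < 1 ->
  prox lambda phi z w -> prox lambda phi z' w' ->
  (1 - lambda * rho) * enorm (w' - w) <= enorm (z' - z).
Proof.
move=> l0 lr pw pw'.
have := prox_cocoercive l0 pw pw'.
have [->|w0] := eqVneq (enorm (w' - w)) 0; first by rewrite mulr0 enorm_ge0.
have {}w0 : 0 < enorm (w' - w) by rewrite lt_neqAle eq_sym w0 enorm_ge0.
move=> H; rewrite -(ler_pM2r w0) -mulrA -expr2; apply: le_trans H _.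
exact: dotr_le.
Qed.

End WeaklyConvex.

(** * The finite sum plus a weakly convex term *)

Section Composite.
Variables (R : realType) (d n : nat).
Variables (f : 'I_n -> 'rV[R]_d -> R) (phi : 'rV[R]_d -> \bar R) (L rho : R).
Hypotheses (n_gt0 : (0 < n)%N)
  (f_diff : forall (i : 'I_n) (x : 'rV[R]_d), differentiable (f i) x)
  (f_lip : forall (i : 'I_n) (x y : 'rV[R]_d), dom phi x -> dom phi y ->
       enorm (grad (f i) x - grad (f i) y) <= L * enorm (x - y))
  (phi_wconvex : weakly_convex rho phi) (phi_proper : proper phi).
Implicit Types (x y z w : 'rV[R]_d) (lambda : R).

Let phr x : R := fine (phi x).

Definition gradavg x : 'rV[R]_d := n%:R^-1 *: \sum_(i < n) grad (f i) x.

Let nR0 : 0 < n%:R :> R. Proof. by rewrite ltr0n. Qed.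

Lemma dotr_gradavg x v : dotr (gradavg x) v = n%:R^-1 * \sum_(i < n) dotr (grad (f i) x) v.
Proof. by rewrite dotrZl dotr_suml. Qed.

Lemma favg_le (c : R) (F : 'I_n -> R) : (forall i, F i <= c) -> n%:R^-1 * \sum_(i < n) F i <= c.
Proof.
move=> H; rewrite ler_pdivrMl//; apply: le_trans (ler_sum _ (fun i _ => H i)) _.
by rewrite sumr_const card_ord mulr_natl.
Qed.

Lemma gradavg_lip x y : dom phi x -> dom phi y ->
  enorm (gradavg x - gradavg y) <= L * enorm (x - y).
Proof.
move=> dx dy; rewrite -scalerBr -sumrB enormZ ger0_norm ?invr_ge0//.
apply: le_trans (favg_le (fun i => f_lip i dx dy)).
by rewrite ler_wpM2l ?invr_ge0// ler_enorm_sum.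
Qed.

Lemma favg_descent x y : dom phi x -> dom phi y ->
  favg f y <= favg f x + dotr (gradavg x) (y - x) + L / 2 * enorm (y - x) ^+ 2.
Proof.
move=> dx dy.
have H i : f i y - f i x - dotr (grad (f i) x) (y - x) <= L / 2 * enorm (y - x) ^+ 2.
  suff : f i y <= f i x + dotr (grad (f i) x) (y - x) + L / 2 * enorm (y - x) ^+ 2 by lra.
  apply: descent_lemma => // t t01.
  have E : x + t *: (y - x) = t *: y + (1 - t) *: x.
    by rewrite scalerBr scalerBl scale1r addrCA.
  (* Weak convexity makes [dom phi] convex, so the segment stays where the gradients are
     Lipschitz. *)
  have dt : dom phi (x + t *: (y - x)).
    by rewrite E; have [] := weakly_convex_fine phi_wconvex phi_proper dy dx t01.
  by have := f_lip i dt dx; rewrite [_ - x in leRHS]addrAC subrr add0r.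
have := favg_le H; rewrite !sumrB !mulrBr -dotr_gradavg /favg; lra.
Qed.

Lemma near_favg_taylor x (e : R) : 0 < e -> \forall y \near x,
  favg f x + dotr (gradavg x) (y - x) - e * enorm (y - x) <= favg f y.
Proof.
move=> e0.
near=> y.
have H i : `|f i y - f i x - dotr (grad (f i) x) (y - x)| <= e * enorm (y - x).
  by move: i; near: y; apply: filter_forall => i; exact: near_taylor1.
have : n%:R^-1 * \sum_(i < n) (f i x - f i y + dotr (grad (f i) x) (y - x)) <=
    e * enorm (y - x).
  apply: favg_le => i; have := H i; rewrite ler_norml => /andP[]; lra.
rewrite big_split/= sumrB !mulrDr mulrN -dotr_gradavg /favg; lra.
Unshelve. all: by end_near.
Qed.

Lemma objective_fine x : dom phi x ->
  objective f phi x = (favg f x + phr x)%:E.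
Proof. by move=> dx; rewrite /objective {1}(dom_fine phi_proper dx). Qed.

(** The quadratic slack is below e / 2 |y - x| once |y - x| < e / rho, and the other half of e pays
    for the Taylor error of the smooth part. It serves the iterates and, with v = - [gradavg f x],
    their limit. *)
Lemma subdiff_objective x v : 0 < rho -> dom phi x ->
  (forall y, dom phi y -> phr x + dotr v (y - x) - rho / 2 * enorm (y - x) ^+ 2 <= phr y) ->
  subdiff (objective f phi) x (gradavg x + v).
Proof.
move=> r0 dx H; split; first by rewrite /dom/= objective_fine// ltry.
move=> e e0.
have e2 : 0 < e / 2 by rewrite divr_gt0.
have er : 0 < e / rho by rewrite divr_gt0.
near=> y.
have Fy : favg f x + dotr (gradavg x) (y - x) - e / 2 * enorm (y - x) <= favg f y.
  by near: y; exact: near_favg_taylor.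
have yx : enorm (y - x) < e / rho by near: y; exact: near_enorm_lt.
have [dy|ndy] := pselect (dom phi y); last first.
  have -> : objective f phi y = +oo%E.
    by rewrite /objective; move: ndy; rewrite /dom/=; case: (phi y) => [r| |] //=; rewrite ?ltry ?ltNyr.
  exact: leey.
rewrite !objective_fine// -EFinD lee_fin dotrDl.
have := H y dy; set N := enorm (y - x) in Fy yx *.
have : rho / 2 * N ^+ 2 <= e / 2 * N.
  have -> : rho / 2 * N ^+ 2 = rho * N / 2 * N by field.
  rewrite ler_wpM2r ?enorm_ge0// ler_pM2r ?invr_gt0//.
  by rewrite mulrC -ler_pdivlMr// ltW.
lra.
Unshelve. all: by end_near.
Qed.

End Composite.


(** * One epoch of norm-PRR *)

Section NormPRR.
Variables (R : realType) (d n : nat).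
Variables (f : 'I_n -> 'rV[R]_d -> R) (phi : 'rV[R]_d -> \bar R) (L rho lambda : R).
Hypotheses (n_gt0 : (0 < n)%N)
  (f_diff : forall (i : 'I_n) (x : 'rV[R]_d), differentiable (f i) x)
  (L_gt0 : 0 < L)
  (f_lip : forall (i : 'I_n) (x y : 'rV[R]_d), dom phi x -> dom phi y ->
       enorm (grad (f i) x - grad (f i) y) <= L * enorm (x - y))
  (rho_gt0 : 0 < rho)
  (phi_wconvex : weakly_convex rho phi) (phi_proper : proper phi)
  (lambda_gt0 : 0 < lambda) (lambda_rho : 4 * (lambda * rho) < 1).
Implicit Types (x y z w : 'rV[R]_d).

Let phr x : R := fine (phi x).
Let psir x : R := favg f x + phr x.

(** Robinson's normal map. It takes both points because [prox] is a relation, not a function of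
    z. *)
Definition normal_map z w : 'rV[R]_d := gradavg f w + lambda^-1 *: (z - w).

Lemma enorm_sqr_add3 x y z :
  enorm (x + y + z) ^+ 2 <= 3 * (enorm x ^+ 2 + enorm y ^+ 2 + enorm z ^+ 2).
Proof.
have := dotr_ge0 (x - y); have := dotr_ge0 (x - z); have := dotr_ge0 (y - z).
rewrite !enorm_sqr !dotrE (dotrC y x) (dotrC z x) (dotrC z y); lra.
Qed.

Lemma merit_step (a t : R) z w z' w' (e : 'rV[R]_d) :
  let F := normal_map z w in let F' := normal_map z' w' in
  prox lambda phi z w -> prox lambda phi z' w' -> z' = z - a *: F + e ->
  0 < a -> 0 < t <= tauPRR rho L lambda ->
  a <= lambda / 4 -> a * (16 * (L + rho)) <= 1 ->
  a * (24 * (lambda * L ^+ 2 + lambda^-1)) <= 1 ->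
  psir w' + t * lambda / 2 * enorm F' ^+ 2 <= psir w + t * lambda / 2 * enorm F ^+ 2
    - t * a / 4 * enorm F ^+ 2 - enorm (w' - w) ^+ 2 / (8 * a) + 8 * (enorm e ^+ 2 / a).
Proof.
move=> F F' pw pw' zE a0 tt al aL aL2.
have dw := prox_dom phi_proper pw; have dw' := prox_dom phi_proper pw'.
have il0 : 0 < lambda^-1 by rewrite invr_gt0.
set p := w' - w; pose G := gradavg f w' - gradavg f w.
have zp : dotr (z' - z) p = - a * dotr F p + dotr e p.
  by rewrite zE !dotrE; ring.
apply: (@descent_scalar _ a lambda rho L t (psir w) (psir w') (enorm F) (enorm p)
  (enorm e) (enorm F') (dotr F p) (dotr e p) (dotr F e) (dotr F G)) => //;
  rewrite ?enorm_ge0 ?dotr_le//.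
- have := favg_descent n_gt0 f_diff f_lip phi_wconvex phi_proper dw dw'.
  have := prox_ineq phi_wconvex phi_proper lambda_gt0 pw' dw.
  rewrite -/p [enorm (w - w')]enormC -/p -!/(phr _).
  have -> : dotr (z' - w') (w - w') = - dotr (z - w) p - (- a * dotr F p + dotr e p)
      + enorm p ^+ 2.
    by rewrite -zp enorm_sqr /p !dotrE (dotrC w' w); ring.
  have : dotr F p = dotr (gradavg f w) p + lambda^-1 * dotr (z - w) p.
    by rewrite /F /normal_map dotrDl [dotr (lambda^-1 *: _) _]dotrZl.
  rewrite /psir; lra.
- by rewrite -zp; exact: (prox_cocoercive phi_wconvex phi_proper).
(* Substituting the step into z' - w' contracts F by 1 - a / lambda; the error, the gradient
   increment and the step p make up [q]. *)
- pose b := 1 - a / lambda; pose q := lambda^-1 *: e + G + (- lambda^-1) *: p.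
  have FE : F' = b *: F + q.
    rewrite /F' /normal_map zE /q /G /p /b.
    have -> : z - a *: F + e - w' = (z - w) - a *: F + e - (w' - w).
      by apply/rowP => j; rewrite !mxE; ring.
    by apply/rowP => j; rewrite /F /normal_map !mxE; ring.
  have qE := enorm_sqr_add3 (lambda^-1 *: e) G (- lambda^-1 *: p).
  have Gp : enorm G ^+ 2 <= L ^+ 2 * enorm p ^+ 2.
    rewrite -exprMn lerXn2r ?nnegrE ?enorm_ge0 ?mulr_ge0 ?enorm_ge0 ?(ltW L_gt0)//.
    exact: (gradavg_lip n_gt0 f_lip dw' dw).
  have -> : enorm F' ^+ 2 = b ^+ 2 * enorm F ^+ 2 + 2 * b * dotr F q + enorm q ^+ 2.
    have sqE (u v : 'rV[R]_d) : enorm (b *: u + v) ^+ 2 =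
        b ^+ 2 * enorm u ^+ 2 + 2 * b * dotr u v + enorm v ^+ 2.
      by rewrite !enorm_sqr !dotrE (dotrC v u); ring.
    by rewrite FE sqE.
  have -> : dotr F q = dotr F e / lambda + dotr F G - dotr F p / lambda.
    have qE' (x y u v : 'rV[R]_d) : dotr x (lambda^-1 *: y + u + - lambda^-1 *: v) =
        dotr x y / lambda + dotr x u - dotr x v / lambda.
      by rewrite !dotrE; ring.
    exact: qE'.
  have qq : enorm q ^+ 2 <= 3 * (enorm e ^+ 2 / lambda ^+ 2 + L ^+ 2 * enorm p ^+ 2
      + enorm p ^+ 2 / lambda ^+ 2).
    apply: le_trans qE _; rewrite !enormZ !exprMn !real_normK ?num_real// sqrrN exprVn.
    rewrite ler_pM2l// ![_^-1 * _]mulrC; lra.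
  by rewrite lerD2l.
- apply: le_trans (dotr_le _ _) _; rewrite ler_wpM2l ?enorm_ge0//.
  exact: (gradavg_lip n_gt0 f_lip dw' dw).
Qed.

(** Here |e|^2 / a <= 2 Ce^2 a^3 (1 + X^2). The X^2 part is absorbed by half of the decrease t a / 4
    X^2 once 128 Ce^2 a^2 <= t, and only the a^3 part remains. *)
Lemma merit_step_error (a t Ce : R) z w z' w' :
  let F := normal_map z w in let F' := normal_map z' w' in
  prox lambda phi z w -> prox lambda phi z' w' ->
  enorm (z' - (z - a *: F)) <= Ce * a ^+ 2 * (1 + enorm F) -> 0 <= Ce ->
  0 < a -> 0 < t <= tauPRR rho L lambda ->
  a <= lambda / 4 -> a * (16 * (L + rho)) <= 1 ->
  a * (24 * (lambda * L ^+ 2 + lambda^-1)) <= 1 -> a <= 1 -> a * (128 * Ce ^+ 2 / t) <= 1 ->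
  psir w' + t * lambda / 2 * enorm F' ^+ 2 <= psir w + t * lambda / 2 * enorm F ^+ 2
    - t * a / 8 * enorm F ^+ 2 - enorm (w' - w) ^+ 2 / (8 * a) + 16 * Ce ^+ 2 * a ^+ 3.
Proof.
move=> F F' pw pw' He Ce0 a0 tt al aL aL2 a1 aC.
have zE : z' = z - a *: F + (z' - (z - a *: F)) by rewrite addrC subrK.
apply: le_trans (merit_step pw pw' zE a0 tt al aL aL2) _; rewrite -/F -/F'.
set e := z' - _ in He *; set X := enorm F in He *.
have X0 : 0 <= X by exact: enorm_ge0.
have /andP[t0 _] := tt.
have Ee : enorm e ^+ 2 / a <= 2 * Ce ^+ 2 * a ^+ 3 * (1 + X ^+ 2).
  rewrite ler_pdivrMr//; apply: (@le_trans _ _ ((Ce * a ^+ 2 * (1 + X)) ^+ 2)).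
    by rewrite lerXn2r ?nnegrE ?enorm_ge0// (le_trans _ He)// enorm_ge0.
  have -> : (Ce * a ^+ 2 * (1 + X)) ^+ 2 = (Ce * a ^+ 2) ^+ 2 * (1 + X) ^+ 2 by ring.
  have -> : 2 * Ce ^+ 2 * a ^+ 3 * (1 + X ^+ 2) * a = (Ce * a ^+ 2) ^+ 2 * (2 * (1 + X ^+ 2)) by ring.
  by rewrite ler_wpM2l ?sqr_ge0//; have := sqr_ge0 (1 - X); lra.
have aC2 : a ^+ 2 * (128 * Ce ^+ 2) <= t.
  have : a * (128 * Ce ^+ 2) <= t by move: aC; rewrite mulrA ler_pdivrMr// mul1r.
  apply: le_trans; rewrite ler_wpM2r ?mulr_ge0 ?sqr_ge0//.
  by rewrite expr2 ler_piMl// ltW.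
have aX : 0 <= a * X ^+ 2 by rewrite mulr_ge0 ?sqr_ge0// ltW.
have := ler_wpM2r aX aC2; lra.
Qed.

Let T (i : 'I_n) z w : 'rV[R]_d := grad (f i) w + lambda^-1 *: (z - w).

(** Lipschitz modulus in z of [T i z w] when w is the proximal point of z, the proximal map having
    modulus 1 / (1 - lambda rho). *)
Definition lipT : R := (L + lambda^-1) / (1 - lambda * rho) + lambda^-1.

Lemma lipT_gt0 : 0 < lipT.
Proof.
have lr : 0 < 1 - lambda * rho.
  by have := lambda_rho; have := mulr_gt0 lambda_gt0 rho_gt0; lra.
by rewrite addr_gt0 ?invr_gt0// divr_gt0// addr_gt0 ?invr_gt0.
Qed.

Lemma T_lip i z w z' w' : prox lambda phi z w -> prox lambda phi z' w' ->
  enorm (T i z' w' - T i z w) <= lipT * enorm (z' - z).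
Proof.
move=> pw pw'.
have lr0 : 0 < lambda * rho by rewrite mulr_gt0.
have lr1 : 0 < 1 - lambda * rho by have := lambda_rho; lra.
have il0 : 0 < lambda^-1 by rewrite invr_gt0.
have dw := prox_dom phi_proper pw; have dw' := prox_dom phi_proper pw'.
have -> : T i z' w' - T i z w = (grad (f i) w' - grad (f i) w) + lambda^-1 *: (z' - z)
    + (- lambda^-1) *: (w' - w).
  by apply/rowP => j; rewrite /T !mxE; ring.
have pl : enorm (w' - w) <= enorm (z' - z) / (1 - lambda * rho).
  rewrite ler_pdivlMr// mulrC.
  apply: (prox_lipschitz phi_wconvex phi_proper lambda_gt0 _ pw pw'); lra.
apply: le_trans (ler_enormD _ _) _.
apply: le_trans (lerD (ler_enormD _ _) (lexx _)) _.
rewrite !enormZ normrN !gtr0_norm//.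
have := f_lip i dw' dw.
have Ll : 0 <= L + lambda^-1 by rewrite addr_ge0 ?ltW.
have := ler_wpM2l Ll pl.
rewrite /lipT; lra.
Qed.

(** Since al lipT <= 1, the drift D_i = |z_i - z| obeys D_(i+1) <= 2 D_i + al B and stays of order
    al. Each direction thus differs by O(al) from the one frozen at (z, w), and the step contributes
    the second factor al. *)
Lemma inner_error (al B : R) z w (zi wi : nat -> 'rV[R]_d) (s : 'S_n) :
  0 < al -> al * lipT <= 1 -> 0 <= B -> prox lambda phi z w -> zi 0 = z -> wi 0 = w ->
  (forall i : 'I_n, zi i.+1 = zi i - al *: T (s i) (zi i) (wi i)) ->
  (forall i : 'I_n, prox lambda phi (zi i.+1) (wi i.+1)) ->
  (forall i : 'I_n, enorm (T i z w) <= B) ->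
  enorm (zi n - (z - (n%:R * al) *: normal_map z w)) <=
    al ^+ 2 * (n%:R * lipT * 2 ^+ n) * B.
Proof.
move=> al0 al1 B0 pw z0 w0 zstep zprox HB.
have lT0 := lipT_gt0.
have pwi i : (i <= n)%N -> prox lambda phi (zi i) (wi i).
  by case: i => [|i] ile; [rewrite z0 w0|exact: (zprox (Ordinal ile))].
have Di i : (i <= n)%N -> enorm (zi i - z) <= (2 ^+ i - 1) * (al * B).
  elim: i => [_|i IH ile]; first by rewrite z0 subrr enorm0 expr0 subrr mul0r.
  have {}IH := IH (ltnW ile).
  have -> := zstep (Ordinal ile); rewrite /=.
  set Ti := T _ _ _.
  have TiB : enorm Ti <= B + lipT * enorm (zi i - z).
    rewrite /Ti; set j := s _; rewrite -[T j (zi i) (wi i)](subrK (T j z w)) addrC.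
    by apply: le_trans (ler_enormD _ _) _; rewrite lerD//; exact: T_lip pw (pwi _ (ltnW ile)).
  rewrite addrAC; apply: le_trans (ler_enormB _ _) _.
  rewrite enormZ gtr0_norm//.
  have := ler_wpM2l (ltW al0) TiB.
  have := ler_wpM2r (enorm_ge0 (zi i - z)) al1.
  rewrite exprS; lra.
have -> : zi n - (z - (n%:R * al) *: normal_map z w) =
   - al *: \sum_(i < n) (T (s i) (zi i) (wi i) - T (s i) z w).
  rewrite sumrB.
  have -> : \sum_(i < n) T (s i) z w = n%:R *: normal_map z w.
    rewrite /T big_split/= sumr_const card_ord /normal_map [RHS]scalerDr -[_ *+ n]scaler_nat; congr (_ + _).
    rewrite scalerA mulfV ?pnatr_eq0 -?lt0n// scale1r.
    by rewrite [RHS](reindex_inj (@perm_inj _ s)).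
  rewrite scalerBr scalerA mulNr !scaleNr opprK [al * _]mulrC opprB addrA addrAC.
  congr (_ + _).
  rewrite -z0 -(telescope_sumr zi (leq0n n)) big_mkord scaler_sumr -sumrN.
  by apply: eq_bigr => i _; rewrite zstep addrAC subrr add0r.
rewrite enormZ normrN gtr0_norm//.
have -> : al ^+ 2 * (n%:R * lipT * 2 ^+ n) * B = al * (n%:R * (lipT * (2 ^+ n * (al * B)))) by ring.
rewrite ler_pM2l//; apply: le_trans (ler_enorm_sum _) _.
have alB : 0 <= al * B by rewrite mulr_ge0// ltW.
have H (i : 'I_n) : enorm (T (s i) (zi i) (wi i) - T (s i) z w) <= lipT * (2 ^+ n * (al * B)).
  apply: le_trans (T_lip _ pw (pwi i (ltnW (ltn_ord i)))) _.
  rewrite ler_pM2l//; apply: le_trans (Di i (ltnW (ltn_ord i))) _.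
  rewrite ler_wpM2r// (@le_trans _ _ (2 ^+ i)) ?gerBl//.
  by rewrite ler_eXn2l ?ltr1n// ltnW.
apply: le_trans (ler_sum _ (fun i _ => H i)) _.
by rewrite sumr_const card_ord mulr_natl.
Qed.

End NormPRR.


Lemma bigO_rateI (R : realType) (v : nat -> \bar R) (s K : R) :
  (\forall k \near \oo, (0 <= v k <= (K * k%:R `^ (- s))%:E)%E) -> bigO_rate v s.
Proof.
move=> H; split.
  near=> k; have /andP[v0 vK] : (0 <= v k <= (K * k%:R `^ (- s))%:E)%E by near: k.
  by rewrite fin_numE; apply/andP; split;
    [rewrite gt_eqF// (lt_le_trans _ v0)// ltNyr|rewrite lt_eqF// (le_lt_trans vK)// ltry].
apply/eqO_exP; exists (`|K| + 1); first by rewrite /= ltr_wpDl.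
near=> k; have /andP[v0 vK] : (0 <= v k <= (K * k%:R `^ (- s))%:E)%E by near: k.
rewrite ger0_norm ?fine_ge0// (ger0_norm (powR_ge0 _ _)).
apply: (@le_trans _ _ (K * k%:R `^ (- s))).
  by rewrite -lee_fin fineK// ge0_fin_numE// (le_lt_trans vK)// ltry.
by rewrite ler_wpM2r ?powR_ge0// (le_trans (ler_norm _))// lerDl.
Unshelve. all: by end_near.
Qed.

(** The relation on r gives r (1 - th) = gam + th r - 1. *)
Lemma path_exponent (R : realType) (gam th r : R) :
  th * r <= th * (3 * gam - 1) ->
  r * (2 * th - 1) = 1 - gam \/ [/\ r = 2, th = 2^-1 & gam = 1] ->
  r * (1 - th) <= gam + th * (3 * gam - 1) - 1.
Proof. by move=> rq [rE|[-> -> ->]]; lra. Qed.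

(** gam <= 1 places the threshold at or above 1/2. The last bound yields gam + th (3 gam - 1) >= 2
    gam > 1, the summability condition of [KL_path]. *)
Lemma exponent_bounds (R : realType) (gam th : R) : 2^-1 < gam <= 1 ->
  gam / (3 * gam - 1) <= th -> th < 1 ->
  [/\ 0 < th < 1, 1 <= 2 * th & gam <= th * (3 * gam - 1)].
Proof.
move=> /andP[g2 g1] gth th1; have q0 : 0 < 3 * gam - 1 by lra.
have th2 : 2^-1 <= th by apply: le_trans gth; rewrite ler_pdivlMr//; lra.
by split; [lra|lra|rewrite -ler_pdivrMr].
Qed.

(** r <= 3 gam - 1 amounts to th >= gam / (3 gam - 1). The strict gam < 1 gives th > 1/2, so the
    quotient r has a positive denominator. *)
Lemma superlinear_exponent (R : realType) (gam th : R) : 2^-1 < gam < 1 ->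
  gam / (3 * gam - 1) <= th -> th < 1 ->
  let r := (1 - gam) / (2 * th - 1) in
  [/\ 2^-1 < th < 1, 0 < r, r <= 3 * gam - 1 & r * (2 * th - 1) = 1 - gam].
Proof.
move=> /andP[g2 g1] gth th1 r; have q0 : 0 < 3 * gam - 1 by lra.
have th2 : 2^-1 < th by apply: lt_le_trans gth; rewrite ltr_pdivlMr//; lra.
have t0 : 0 < 2 * th - 1 by lra.
rewrite ler_pdivrMr// in gth.
split; first by rewrite th2.
- by rewrite divr_gt0// subr_gt0.
- by rewrite ler_pdivrMr//; lra.
- by rewrite divfK// gt_eqF.
Qed.

(* With [gamma = 1] the descent coefficient is of the form [s / (8 (beta + k))]. *)
Lemma harmonic_domination (R : realType) (m s b : R) : 0 < m -> 16 * m < s -> 0 <= b ->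
  exists2 Q, 2 < Q & \forall k \near \oo, m * (Q * k%:R^-1) <= s / (8 * (b + k%:R)).
Proof.
move=> m0 ms b0; pose v := s / (8 * m).
have v2 : 2 < v by rewrite ltr_pdivlMr ?mulr_gt0//; lra.
have vQ : 0 < v - (v + 2) / 2 by lra.
(* Halfway between 2 and v; the margin v - Q absorbs the shift b for large k. *)
exists ((v + 2) / 2); first by lra.
near=> k.
have k0 : (0 < k)%N by near: k; exact: near_lt0n.
have kR : 0 < k%:R :> R by rewrite ltr0n.
have bk : 0 < b + k%:R by rewrite ltr_wpDl.
have : (v + 2) / 2 * b / (v - (v + 2) / 2) <= k%:R.
  by near: k; exact: nbhs_infty_ger.
have -> : s / (8 * (b + k%:R)) = m * (v / (b + k%:R)).
  by rewrite /v; field; rewrite !gt_eqF.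
rewrite ler_pM2l// ler_pdivrMr// => kbig.
rewrite ler_pdivrMr// mulrAC ler_pdivlMr//; lra.
Unshelve. all: by end_near.
Qed.

(** * Convergence and rates of norm-PRR *)

Section Iterates.
Variables (R : realType) (d n : nat).
Variables (f : 'I_n -> 'rV[R]_d -> R) (phi : 'rV[R]_d -> \bar R).
Variables (L rho flb philb lambda alpha beta gamma : R).
Variables (pi : nat -> 'S_n) (z w : nat -> 'rV[R]_d).
Hypotheses (n_gt0 : (0 < n)%N)
  (f_diff : forall (i : 'I_n) (x : 'rV[R]_d), differentiable (f i) x)
  (L_gt0 : 0 < L)
  (f_lip : forall (i : 'I_n) (x y : 'rV[R]_d), dom phi x -> dom phi y ->
       enorm (grad (f i) x - grad (f i) y) <= L * enorm (x - y))
  (rho_gt0 : 0 < rho)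
  (phi_wconvex : weakly_convex rho phi) (phi_lsc : lower_semicontinuous phi)
  (phi_proper : proper phi)
  (f_bound : forall (i : 'I_n) (x : 'rV[R]_d), dom phi x -> flb <= f i x)
  (phi_bound : forall x : 'rV[R]_d, dom phi x -> (philb%:E <= phi x)%E)
  (lambda_gt0 : 0 < lambda) (lambda_rho : 4 * (lambda * rho) < 1)
  (alpha_gt0 : 0 < alpha) (beta_ge0 : 0 <= beta)
  (gamma_range : 2^-1 < gamma <= 1)
  (w_PRR : normPRR f phi lambda
       (fun k => alpha / ((beta + k%:R) `^ gamma)) pi z w)
  (w_bounded : bounded_fun w).

Let tau := tauPRR rho L lambda.
Let al k : R := alpha / ((beta + k%:R) `^ gamma).
Let a k : R := n%:R * al k.
Let F k := normal_map f lambda (z k) (w k).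
Let X k := enorm (F k).
Let p k := enorm (w k.+1 - w k).
Let phr x : R := fine (phi x).
Let S k := favg f (w k) + phr (w k).

Lemma tau_gt0 : 0 < tau.
Proof.
have lr := mulr_gt0 lambda_gt0 rho_gt0.
have := mulr_gt0 (exprn_gt0 2 lambda_gt0) (exprn_gt0 2 L_gt0).
by have := lambda_rho; move=> *; rewrite /tau /tauPRR divr_gt0//; lra.
Qed.

Lemma iterate_prox k : (0 < k)%N -> prox lambda phi (z k) (w k).
Proof.
case: k => // -[_|k _]; first by case: w_PRR.
have [_ /(_ k.+1 isT)[zi [wi [_ _ H [-> ->]]]]] := w_PRR.
by case: (n) n_gt0 H => // m _ H; exact: H ord_max.
Qed.

Lemma iterate_dom k : (0 < k)%N -> dom phi (w k).
Proof. by move=> /iterate_prox; exact: prox_dom. Qed.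

(** The iterates are bounded and lie in [dom phi], so the Lipschitz bound from [w 1] controls every
    gradient. The index 0 is excluded because the algorithm does not produce [w 0]. *)
Lemma iterate_grad_bound : exists2 Cg : R, 0 <= Cg &
  forall (i : 'I_n) k, (0 < k)%N -> enorm (grad (f i) (w k)) <= Cg.
Proof.
have [M [_ HM]] := w_bounded.
have Hw k : `|w k| <= M + 1 by apply: HM; rewrite ?ltrDl.
have Hew k : enorm (w k) <= d%:R * (M + 1).
  by apply: le_trans (enorm_le_norm _) _; rewrite ler_wpM2l.
have M0 : 0 <= d%:R * (M + 1) by apply: le_trans (enorm_ge0 _) (Hew 0%N).
move: (d%:R * (M + 1)) Hew M0 => M1 Hew M0.
exists (\sum_i enorm (grad (f i) (w 1%N)) + L * (2 * M1)).
  rewrite addr_ge0 ?mulr_ge0 ?(ltW L_gt0)//.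
  by apply: sumr_ge0 => i _; exact: enorm_ge0.
move=> i k k0.
rewrite -[grad (f i) (w k)](subrK (grad (f i) (w 1%N))) addrC.
apply: le_trans (ler_enormD _ _) _; apply: lerD.
  by rewrite (bigD1 i)//= lerDl sumr_ge0// => j _; exact: enorm_ge0.
apply: le_trans (f_lip i (iterate_dom k0) (iterate_dom (ltn0Sn 0))) _.
rewrite ler_wpM2l ?(ltW L_gt0)//; apply: le_trans (ler_enormB _ _) _.
by have := Hew k; have := Hew 1%N; lra.
Qed.

Lemma gradavg_bound (Cg : R) k :
  (forall i : 'I_n, enorm (grad (f i) (w k)) <= Cg) -> enorm (gradavg f (w k)) <= Cg.
Proof.
move=> H; rewrite enormZ ger0_norm ?invr_ge0//.
apply: le_trans (favg_le n_gt0 H).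
by rewrite ler_wpM2l ?invr_ge0// ler_enorm_sum.
Qed.

Lemma iterate_lower_bound k : (0 < k)%N -> flb + philb <= S k.
Proof.
move=> k0; have dk := iterate_dom k0.
rewrite lerD//.
  rewrite /favg ler_pdivlMl ?ltr0n//.
  apply: le_trans (ler_sum _ (fun i _ => f_bound i dk)).
  by rewrite sumr_const card_ord mulr_natl.
by have := phi_bound dk; rewrite {1}(dom_fine phi_proper dk) lee_fin.
Qed.

Lemma step_bounds : \forall k \near \oo,
  n%:R * alpha / (beta + 1) `^ gamma * k%:R `^ (- gamma) <= a k <= n%:R * alpha * k%:R `^ (- gamma).
Proof.
have /andP[g2 g1] := gamma_range.
have g0 : 0 <= gamma by lra.
have b1 : 0 < beta + 1 by rewrite ltr_wpDl.
near=> k.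
have k0 : (0 < k)%N by near: k; exact: near_lt0n.
have kR : 0 < k%:R :> R by rewrite ltr0n.
have k1 : 1 <= k%:R :> R by rewrite ler1n.
have bk : 0 < beta + k%:R by rewrite ltr_wpDl.
have na : 0 < n%:R * alpha by rewrite mulr_gt0// ltr0n.
have -> : a k = n%:R * alpha * ((beta + k%:R) `^ gamma)^-1 by rewrite /a /al mulrA.
rewrite powRN; apply/andP; split.
  rewrite -mulrA -invfM ler_pM2l// lef_pV2 ?posrE ?mulr_gt0 ?powR_gt0//.
  rewrite -powRM ?(ltW b1) ?(ltW kR)//; apply: ge0_ler_powR; rewrite ?nnegrE ?mulr_ge0 ?(ltW b1) ?(ltW kR) ?(ltW bk)//.
  by rewrite mulrDl mul1r lerD2r ler_peMr.
rewrite ler_pM2l// lef_pV2 ?posrE ?powR_gt0//.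
by apply: ge0_ler_powR; rewrite ?nnegrE ?(ltW kR) ?(ltW bk)// lerDr.
Unshelve. all: by end_near.
Qed.

Lemma step_gt0 k : (0 < k)%N -> 0 < al k.
Proof.
by move=> k0; rewrite divr_gt0// powR_gt0// ltr_wpDl// ltr0n.
Qed.

Lemma step_small (K : R) : \forall k \near \oo, a k * K <= 1.
Proof.
have /andP[g2 g1] := gamma_range.
have g0 : 0 < gamma by lra.
have na : 0 < n%:R * alpha by rewrite mulr_gt0// ltr0n.
have K0 : 0 < `|K| + 1 by rewrite ltr_wpDl.
near=> k.
have k0 : (0 < k)%N by near: k; exact: near_lt0n.
have ak : 0 < a k by rewrite mulr_gt0 ?ltr0n// step_gt0.
have /andP[_ ak1] : n%:R * alpha / (beta + 1) `^ gamma * k%:R `^ (- gamma) <= a k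
    <= n%:R * alpha * k%:R `^ (- gamma) by near: k; exact: step_bounds.
have ks : k%:R `^ (- gamma) < (n%:R * alpha * (`|K| + 1))^-1.
  by near: k; apply: powRN_lt => //; rewrite invr_gt0 mulr_gt0.
apply: (@le_trans _ _ (a k * (`|K| + 1))).
  by rewrite ler_pM2l// (le_trans (ler_norm _))// lerDl.
rewrite -ler_pdivlMr// mul1r; apply: le_trans ak1 _.
by rewrite -ler_pdivlMl// -invfM ltW.
Unshelve. all: by end_near.
Qed.

(** [C] is chosen before t, and only the starting index depends on t; this allows a single
    correction u for both t = tau and t = tau / 2. *)
Lemma merit_descent : exists2 C : R, 0 <= C & forall t, 0 < t <= tau -> \forall k \near \oo,
  S k.+1 + t * lambda / 2 * X k.+1 ^+ 2 <= S k + t * lambda / 2 * X k ^+ 2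
    - t * a k / 8 * X k ^+ 2 - p k ^+ 2 / (8 * a k) + C * a k ^+ 3.
Proof.
have [Cg Cg0 HCg] := iterate_grad_bound.
pose c1 := lipT L rho lambda.
have c10 : 0 < c1 by exact: lipT_gt0.
(* The last factor comes from 2 Cg + X <= (2 Cg + 1) (1 + X). *)
pose Ce := n%:R * c1 * 2 ^+ n * (2 * Cg + 1).
have Ce0 : 0 <= Ce.
  by rewrite /Ce mulr_ge0 ?mulr_ge0 ?exprn_ge0 ?(ltW c10)// addr_ge0// mulr_ge0.
exists (16 * Ce ^+ 2); first by rewrite mulr_ge0 ?sqr_ge0.
move=> t tt; near=> k.
have k0 : (0 < k)%N by near: k; exact: near_lt0n.
have al0 := step_gt0 k0.
have n1 : 1 <= n%:R :> R by rewrite ler1n.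
have ak0 : 0 < a k by rewrite mulr_gt0 ?ltr0n.
have alk : al k <= a k by rewrite /a ler_peMl// ltW.
have pk := iterate_prox k0; have pk1 := iterate_prox (ltn0Sn k).
apply: (merit_step_error n_gt0 f_diff L_gt0 f_lip rho_gt0 phi_wconvex phi_proper) => //.
- have [_ /(_ k k0)[zi [wi [[z0 w0] zstep zprox [-> _]]]]] := w_PRR.
  (* A frozen direction is the residual plus the deviation of one gradient from the mean, which is
     at most 2 Cg. *)
  have HB (i : 'I_n) : enorm (grad (f i) (w k) + lambda^-1 *: (z k - w k)) <= 2 * Cg + X k.
    have -> : grad (f i) (w k) + lambda^-1 *: (z k - w k) =
        grad (f i) (w k) - gradavg f (w k) + F k.
      by rewrite /F /normal_map addrA subrK.
    apply: le_trans (ler_enormD _ _) _; rewrite lerD2r.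
    apply: le_trans (ler_enormB _ _) _.
    have := HCg i k k0; have := gradavg_bound (fun i => HCg i k k0); lra.
  have alc : al k * c1 <= 1.
    have : a k * c1 <= 1 by near: k; exact: step_small.
    by apply: le_trans; rewrite ler_pM2r.
  have B0 : 0 <= 2 * Cg + X k by rewrite addr_ge0 ?mulr_ge0 ?enorm_ge0.
  have := inner_error n_gt0 L_gt0 f_lip rho_gt0 phi_wconvex phi_proper lambda_gt0
    lambda_rho al0 alc B0 pk z0 w0 zstep zprox HB.
  rewrite -/c1 -/(a k) => H; apply: le_trans H _.
  rewrite -/(F k) -/(X k) [Ce * _]mulrC -[leRHS]mulrA.
  have -> : Ce * (1 + X k) = n%:R * c1 * 2 ^+ n * ((2 * Cg + 1) * (1 + X k)) by rewrite mulrA.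
  have X0 : 0 <= X k by exact: enorm_ge0.
  have CX : 0 <= Cg * X k by rewrite mulr_ge0.
  rewrite -mulrA; apply: ler_pM.
  - exact: sqr_ge0.
  - by rewrite !mulr_ge0 ?exprn_ge0 ?(ltW c10).
  - by rewrite lerXn2r ?nnegrE ?(ltW al0) ?(ltW ak0).
  - by rewrite ler_wpM2l ?mulr_ge0 ?exprn_ge0 ?(ltW c10)//; lra.
- have : a k * (4 / lambda) <= 1 by near: k; exact: step_small.
  rewrite mulrA ler_pdivrMr// mul1r; lra.
- by near: k; exact: step_small.
- by near: k; exact: step_small.
- by rewrite -[leLHS]mulr1; near: k; exact: step_small.
- by near: k; exact: step_small.
Unshelve. all: by end_near.
Qed.

Lemma normal_map_subdiff k : (0 < k)%N -> subdiff (objective f phi) (w k) (F k).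
Proof.
move=> k0; apply: (subdiff_objective n_gt0 f_diff phi_proper rho_gt0).
  exact: iterate_dom.
move=> y dy; rewrite dotrZl.
exact: (prox_ineq phi_wconvex phi_proper lambda_gt0 (iterate_prox k0) dy).
Qed.

Lemma dist0_subdiff k : (0 < k)%N ->
  (0 <= dist0 (subdiff (objective f phi) (w k)) <= (X k)%:E)%E.
Proof.
move=> k0; apply/andP; split.
  by apply: le_ereal_inf_tmp => _ [g _ <-]; rewrite lee_fin enorm_ge0.
by apply: ereal_inf_lbound; exists (F k) => //; exact: normal_map_subdiff.
Qed.


(** Two descent inequalities compare the smooth part in both directions. For [phi] the bound is
    one-sided: it is the proximal inequality at w k tested with x, where X k <= 1 bounds the
    subgradient. *)
Lemma value_bounds x : dom phi x -> exists2 Q : R, 0 <= Q &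
  forall k, (0 < k)%N -> enorm (w k - x) <= 1 -> X k <= 1 ->
    `|favg f (w k) - favg f x| <= Q * enorm (w k - x) /\
    phr (w k) <= phr x + Q * enorm (w k - x).
Proof.
move=> dx; have [Cg Cg0 HCg] := iterate_grad_bound.
have Gx0 : 0 <= enorm (gradavg f x) by exact: enorm_ge0.
exists (enorm (gradavg f x) + Cg + L / 2 + 1 + rho / 2).
  by have := L_gt0; have := rho_gt0; lra.
move=> k k0; set D := enorm (w k - x) => D1 X1.
have dk := iterate_dom k0.
have D0 : 0 <= D by exact: enorm_ge0.
have DD : D ^+ 2 <= D by rewrite expr2 ler_piMl.
have LD : L * D ^+ 2 <= L * D by rewrite ler_pM2l.
have rD : rho * D ^+ 2 <= rho * D by rewrite ler_pM2l.
have Gk := gradavg_bound (fun i => HCg i k k0).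
have H1 := favg_descent n_gt0 f_diff f_lip phi_wconvex phi_proper dx dk.
have H2 := favg_descent n_gt0 f_diff f_lip phi_wconvex phi_proper dk dx.
have H3 := prox_ineq phi_wconvex phi_proper lambda_gt0 (iterate_prox k0) dx.
have E : lambda^-1 * dotr (z k - w k) (x - w k) =
    dotr (F k) (x - w k) - dotr (gradavg f (w k)) (x - w k).
  by rewrite -dotrZl -dotrNl -dotrDl /F /normal_map addrAC subrr add0r.
rewrite E -!/(phr _) in H3; rewrite (enormC x) -/D in H2 H3; rewrite -/D in H1.
have B1 := dotr_le (gradavg f x) (w k - x).
have B2 := dotr_le (gradavg f (w k)) (x - w k).
have B3 := dotr_ge (F k) (x - w k).
rewrite (enormC x) -/D -/(X k) in B2 B3; rewrite -/D in B1.
have U1 : favg f (w k) <= favg f x + (enorm (gradavg f x) + L / 2) * D.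
  by clear H2 H3 B2 B3 rD Gk; lra.
have U2 : favg f x <= favg f (w k) + (Cg + L / 2) * D.
  by have := ler_wpM2r D0 Gk; clear H1 H3 B1 B3 rD U1; lra.
have U3 : phr (w k) <= phr x + (Cg + 1 + rho / 2) * D.
  have := ler_wpM2r D0 Gk; have := ler_wpM2r D0 X1.
  by clear H1 H2 B1 LD U1 U2; lra.
have GD : 0 <= enorm (gradavg f x) * D by rewrite mulr_ge0.
have CD : 0 <= Cg * D by rewrite mulr_ge0.
have L0 : 0 <= L * D by rewrite mulr_ge0// ltW.
have r0 : 0 <= rho * D by rewrite mulr_ge0// ltW.
clear H1 H2 H3 B1 B2 B3 LD rD Gk DD X1.
rewrite ler_norml; split; first apply/andP; first split.
- by clear U1 U3; lra.
- by clear U2 U3; lra.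
- by clear U1 U2; lra.
Qed.

Lemma cluster_exists : exists x, cluster (w @ \oo) x.
Proof.
have [M [_ HM]] := w_bounded.
have Hw k : `|w k| <= M + 1 by apply: HM; rewrite ?ltrDl.
pose A := [set y : 'rV[R]_d | `|y| <= M + 1].
have cA : compact A.
  apply: bounded_closed_compact.
    exists (M + 1); split; first exact: num_real.
    by move=> r Mr y /= yM; apply: le_trans yM (ltW Mr).
  apply: (@closed_comp _ _ (fun y : 'rV[R]_d => `|y|) [set r | r <= M + 1]).
    by move=> y _; exact: norm_continuous.
  exact: closed_le.
have [|x [_ cx]] := cA (w @ \oo) _; last by exists x.
by exists 0%N => // k _ /=; exact: Hw.
Qed.

Lemma cluster_frequently x : cluster (w @ \oo) x ->
  forall (e : R) N, 0 < e -> exists2 k, (N <= k)%N & enorm (w k - x) < e.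
Proof.
move=> cx e N e0.
have [|y [[k Nk <-] /= wk]] := cx (w @` [set k | (N <= k)%N]) _ _ (near_enorm_lt x e0).
  by exists N => // k /= Nk; exists k.
by exists k.
Qed.

(** * Value, criticality and KL inequality at a cluster point *)

Section Limit.
Variable Ss : R.
Hypotheses (cS : S @ \oo --> Ss) (cX : X @ \oo --> (0 : R)).

Let Xlt (e : R) : 0 < e -> \forall k \near \oo, X k < e.
Proof. by move=> e0; have /cvgr_lt := cX; exact. Qed.

Let Slt (e : R) : 0 < e -> \forall k \near \oo, `|S k - Ss| < e.
Proof.
move=> e0; have /cvgrPdist_lt/(_ e e0) := cS; apply: filterS => k.
by rewrite distrC.
Qed.

(** Semicontinuity of [phi] gives <=, and the one-sided estimate of [value_bounds] gives >=. *)
Lemma cluster_value x : dom phi x ->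
  (forall (e : R) N, 0 < e -> exists2 k, (N <= k)%N & enorm (w k - x) < e) ->
  favg f x + phr x = Ss.
Proof.
move=> dx freq; have [Q Q0 HQ] := value_bounds dx.
apply/eqP; rewrite eq_le; apply/andP; split; apply/ler_addgt0Pr => e e0.
- have e3 : 0 < e / 3 by rewrite divr_gt0.
  have lsc : ((phr x - e / 3)%:E < phi x)%E.
    by rewrite (dom_fine phi_proper dx) lte_fin -/(phr x) gtrBl.
  have [V nV HV] := phi_lsc lsc.
  have [r r0 Hr] := near_enormP nV.
  have [N _ HN] : \forall k \near \oo, [/\ (0 < k)%N, X k < 1 & `|S k - Ss| < e / 3].
    by near=> k; split; near: k; [exact: near_lt0n|exact: Xlt|exact: Slt].
  have Q1 : 0 < Q + 1 by rewrite ltr_wpDl.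
  have m0 : 0 < Num.min (Num.min 1 r) (e / 3 / (Q + 1)) by rewrite !lt_min ltr01 r0 divr_gt0.
  have [k Nk] := freq _ N m0; rewrite !lt_min => /andP[/andP[k1 kr] ke].
  have [k0 Xk Sk] := HN k Nk.
  have [+ _] := HQ k k0 (ltW k1) (ltW Xk); rewrite ler_norml => /andP[H1 _].
  have := HV _ (Hr _ kr); rewrite (dom_fine phi_proper (iterate_dom k0)) lte_fin -/(phr _).
  have : Q * enorm (w k - x) <= e / 3.
    move: ke; rewrite ltr_pdivlMr// mulrC mulrDl mul1r => /ltW ke.
    by apply: le_trans ke; rewrite lerDl enorm_ge0.
  by move: Sk; rewrite ltr_norml /S => /andP[]; lra.
- have e3 : 0 < e / 3 by rewrite divr_gt0.
  have [N _ HN] : \forall k \near \oo, [/\ (0 < k)%N, X k < 1 & `|S k - Ss| < e / 3].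
    by near=> k; split; near: k; [exact: near_lt0n|exact: Xlt|exact: Slt].
  have Q1 : 0 < Q + 1 by rewrite ltr_wpDl.
  have m0 : 0 < Num.min 1 (e / 3 / (Q + 1)) by rewrite !lt_min ltr01 divr_gt0.
  have [k Nk] := freq _ N m0; rewrite !lt_min => /andP[k1 ke].
  have [k0 Xk Sk] := HN k Nk.
  have [+ H2] := HQ k k0 (ltW k1) (ltW Xk); rewrite ler_norml => /andP[_ H1].
  have : Q * enorm (w k - x) <= e / 3.
    move: ke; rewrite ltr_pdivlMr// mulrC mulrDl mul1r => /ltW ke.
    by apply: le_trans ke; rewrite lerDl enorm_ge0.
  by move: Sk; rewrite ltr_norml /S => /andP[]; lra.
Unshelve. all: by end_near.
Qed.

(** By [subdiff_objective] it is enough that - [gradavg f x] is a subgradient of [phi] with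
    quadratic slack. For fixed y this is the limit of the proximal inequality at w k, since
    convergence of the objective values carries over to [phi]. *)
Lemma limit_critical x : dom phi x -> favg f x + phr x = Ss ->
  (fun k => enorm (w k - x)) @ \oo --> (0 : R) -> subdiff (objective f phi) x 0.
Proof.
move=> dx xS cD; have [Q Q0 HQ] := value_bounds dx.
rewrite -(subrr (gradavg f x)).
apply: (subdiff_objective n_gt0 f_diff phi_proper rho_gt0 dx) => y dy.
rewrite -!/(phr _); set N := enorm (y - x); set M := enorm (gradavg f x).
(* [A] is the defect at y and does not depend on k; [E k] below collects the errors of replacing w k
   by x. *)
rewrite -subr_le0; set A := (X in X <= 0).
pose D k := enorm (w k - x).
pose E k := `|S k - Ss| + Q * D k + (X k + L * D k) * (N + D k) + M * D k +
   rho / 2 * (2 * N * D k + D k * D k).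
have cE : E @ \oo --> (0 : R).
  have -> : 0 = `|Ss - Ss| + Q * 0 + (0 + L * 0) * (N + 0) + M * 0
      + rho / 2 * (2 * N * 0 + 0 * 0) :> R.
    by rewrite subrr normr0; ring.
  apply: cvgD; last first.
    by apply: cvgMr; apply: cvgD; [exact: cvgMr|exact: cvgM].
  apply: cvgD; last exact: cvgMr.
  apply: cvgD; last first.
    by apply: cvgM; apply: cvgD; [|exact: cvgMr|exact: cvg_cst|].
  apply: cvgD; last exact: cvgMr.
  by apply: cvg_norm; apply: cvgB; [|exact: cvg_cst].
rewrite -(cvg_lim (@Rhausdorff R) cE); apply: limr_ge; first by apply/cvg_ex; exists 0.
near=> k.
have k0 : (0 < k)%N by near: k; exact: near_lt0n.
have X1 : X k < 1 by near: k; exact: Xlt.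
have D1 : D k < 1 by near: k; have /cvgr_lt := cD; apply.
have [+ _] := HQ k k0 (ltW D1) (ltW X1); rewrite -/(D k) ler_norml => /andP[_ H1].
have D0 : 0 <= D k by exact: enorm_ge0.
have X0 : 0 <= X k by exact: enorm_ge0.
have N0 : 0 <= N by exact: enorm_ge0.
have dk := iterate_dom k0.
have H3 := prox_ineq phi_wconvex phi_proper lambda_gt0 (iterate_prox k0) dy.
rewrite -!/(phr _) in H3.
have yw : enorm (y - w k) <= N + D k.
  by apply: le_trans (ler_enorm_dist _ _ x) _; rewrite [enorm (x - _)]enormC.
have yw2 : enorm (y - w k) ^+ 2 <= N ^+ 2 + 2 * N * D k + D k * D k.
  have -> : N ^+ 2 + 2 * N * D k + D k * D k = (N + D k) ^+ 2 by ring.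
  by rewrite lerXn2r ?nnegrE ?enorm_ge0 ?addr_ge0.
have GL : enorm (gradavg f x - gradavg f (w k)) <= L * D k.
  by rewrite /D enormC (gradavg_lip n_gt0 f_lip).
have E1 : lambda^-1 * dotr (z k - w k) (y - w k) = dotr (F k) (y - w k)
   + dotr (gradavg f x - gradavg f (w k)) (y - w k) + dotr (gradavg f x) (w k - x)
   + dotr (- gradavg f x) (y - x).
  have gen (v g h u : 'rV[R]_d) : dotr v (y - u) - dotr g (y - u) = dotr v (y - u)
      + dotr (h - g) (y - u) + dotr h (u - x) + dotr (- h) (y - x).
    by rewrite !dotrE; ring.
  by rewrite -gen -dotrZl -dotrNl -dotrDl /F /normal_map addrAC subrr add0r.
have yw0 : 0 <= enorm (y - w k) by exact: enorm_ge0.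
have LD0 : 0 <= L * D k by rewrite mulr_ge0// ltW.
have B1 : - ((X k + L * D k) * (N + D k)) <= dotr (F k) (y - w k)
    + dotr (gradavg f x - gradavg f (w k)) (y - w k).
  have := dotr_ge (F k) (y - w k); have := dotr_ge (gradavg f x - gradavg f (w k)) (y - w k).
  have := ler_pM (enorm_ge0 _) yw0 GL yw; have := ler_wpM2l X0 yw; rewrite -/(X k); lra.
have B2 := dotr_ge (gradavg f x) (w k - x); rewrite -/M -/(D k) in B2.
have r2 : 0 <= rho / 2 by rewrite divr_ge0// ltW.
have := ler_wpM2l r2 yw2.
have := ler_norm (Ss - S k); rewrite distrC.
rewrite /A /E -xS /S; rewrite E1 in H3; lra.
Unshelve. all: by end_near.
Qed.

(** Once |S k - Ss| < 1, raising the exponent only weakens the inequality and leaves [c] unchanged;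
    the residual bounds the distance to the subdifferential. *)
Lemma KL_sequence x th0 c th : KL_with (objective f phi) x th0 c ->
  favg f x + phr x = Ss -> th0 <= th -> 0 < th ->
  exists2 r : R, 0 < r & \forall k \near \oo,
    enorm (w k - x) < r -> `|S k - Ss| `^ th <= c * X k.
Proof.
move=> [/andP[th00 th01] c0 dpx [eta eta0 H]] xS th0th thp.
have dx : dom phi x.
  by move: dpx; rewrite /dom/= !ltey /objective; apply: contra_neq => ->; rewrite addey.
have [r r0 Hr] := near_enormP H; exists r => //.
have neta : \forall k \near \oo, (`|S k - Ss|%:E < eta)%E.
  case: eta eta0 {H Hr} => [e e0|_|//]; last by near=> k; rewrite ltry.
  by near=> k; rewrite lte_fin; near: k; apply: Slt; rewrite -lte_fin.
near=> k => wk.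
have k0 : (0 < k)%N by near: k; exact: near_lt0n.
have S1 : `|S k - Ss| < 1 by near: k; exact: Slt.
have Seta : (`|S k - Ss|%:E < eta)%E by near: k.
have cX0 : 0 <= c * X k by rewrite mulr_ge0 ?enorm_ge0// ltW.
(* At equal values the KL inequality is silent. The left side is then 0 thanks to 0 < th, as [powR]
   has 0^0 = 1. *)
have [->|SS] := eqVneq (S k) Ss.
  by rewrite subrr normr0 powR0 ?gt_eqF.
have S0 : 0 < `|S k - Ss| by rewrite normr_gt0 subr_eq0.
have dk := iterate_dom k0.
have := Hr _ wk.
rewrite !(objective_fine f phi_proper)// -!/(phr _) xS -/(S k) -EFinB /=.
rewrite lte_fin S0 Seta => /(_ isT) HK.
apply: (@le_trans _ _ (`|S k - Ss| `^ th0)).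
  by apply: ger_powR => //; rewrite S0 ltW.
have /andP[d0 dX] := dist0_subdiff k0.
rewrite -lee_fin EFinM -poweR_EFin; apply: le_trans HK _.
by rewrite lee_pmul2l// lte_fin.
Unshelve. all: by end_near.
Qed.

End Limit.


Let psi := objective f phi.
Let q : R := 3 * gamma - 1.

Theorem normPRR_convergence
  (psi_KL : forall x : 'rV[R]_d, cluster (w @ \oo) x -> KL_property psi x) :
  exists ws : 'rV[R]_d,
  [/\ w @ \oo --> ws, subdiff psi ws 0 &
    forall theta c : R, KL_with psi ws theta c ->
      let gap := fun k => maxe (dist0 (subdiff psi (w k)) ^+ 2)%E `|psi (w k) - psi ws|%E in
      let err := fun k => (enorm (w k - ws))%:E in
      (gamma < 1 -> forall th, theta <= th -> gamma / q <= th -> th < 1 ->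
         bigO_rate gap ((1 - gamma) / (2 * th - 1)) /\
         bigO_rate err ((1 - gamma) / (2 * th - 1) * (1 - th))) /\
      (theta <= 2^-1 -> gamma = 1 ->
         16 * (c ^+ 2 + tau * lambda / 2) < tau * n%:R * alpha ->
         bigO_rate gap 2 /\ bigO_rate err 1)].
Proof.
have /andP[g2 g1] := gamma_range.
have q0 : 0 < q by rewrite /q; lra.
have tau0 := tau_gt0.
have lambda0 := lambda_gt0.
have tl0 : 0 < tau * lambda / 4 by rewrite divr_gt0// (mulr_gt0 tau0 lambda0).
have na0 : 0 < n%:R * alpha by rewrite mulr_gt0// ltr0n.
have alo0 : 0 < n%:R * alpha / (beta + 1) `^ gamma.
  by rewrite divr_gt0// powR_gt0// ltr_wpDl.
have Slb : \forall k \near \oo, flb + philb <= S k.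
  by near=> k; apply: iterate_lower_bound; near: k; exact: near_lt0n.
have [C C0 HD] := merit_descent.
have [Ss [Cu [Cu0 Gstep XG cG SG]]] :=
  merit_limit lambda_gt0 tau0 gamma_range alo0 C0 step_bounds Slb HD.
have X0 k : 0 <= X k by exact: enorm_ge0.
have p0 k : 0 <= p k by exact: enorm_ge0.
pose u k := Cu * k%:R `^ (- q).
pose G k := S k - Ss + tau * lambda / 2 * X k ^+ 2 + u k.
have XG' : \forall k \near \oo, tau * lambda / 4 * X k ^+ 2 <= G k := XG.
have cG' : G @ \oo --> (0 : R) := cG.
have SG' : \forall k \near \oo, `|S k - Ss| <= G k + u k := SG.
have Gge0 : \forall k \near \oo, 0 <= G k := merit_ge0 lambda0 tau0 XG.
have u0 k : 0 <= u k by rewrite mulr_ge0 ?powR_ge0.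
have cu : u @ \oo --> (0 : R).
  by rewrite -(mulr0 Cu); apply: cvgMr; exact: powRN_cvg0.
have Xlt e : 0 < e -> \forall k \near \oo, X k < e.
  move=> e0; have te : 0 < tau * lambda / 4 * e ^+ 2 by rewrite (mulr_gt0 tl0)// exprn_gt0.
  near=> k.
  have XGk : tau * lambda / 4 * X k ^+ 2 <= G k by near: k.
  have Ge : G k < tau * lambda / 4 * e ^+ 2.
    by near: k; have /cvgr_lt := cG'; exact.
  rewrite -(@ltr_pXn2r _ 2) ?nnegrE ?(ltW e0)//.
  by rewrite -(ltr_pM2l tl0); exact: le_lt_trans Ge.
have cX : X @ \oo --> (0 : R).
  apply/cvgrPdist_lt => e e0; near=> k; rewrite sub0r normrN ger0_norm//.
  by near: k; exact: Xlt.
have cS : S @ \oo --> Ss.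
  apply/cvgrPdist_lt => e e0; have e2 : 0 < e / 2 by rewrite divr_gt0.
  near=> k; rewrite distrC.
  have : `|S k - Ss| <= G k + u k by near: k.
  have : G k < e / 2 by near: k; have /cvgr_lt := cG'; exact.
  have : u k < e / 2 by near: k; have /cvgr_lt := cu; exact.
  by move: (G k) (u k) (`|_|) => ? ? ?; lra.
have th_ok := exponent_bounds gamma_range.
(* Used twice: with some KL data at the cluster point to prove convergence, then with arbitrary
   [theta] and [c] for the rates. *)
have trap x theta c th : KL_with psi x theta c -> favg f x + phr x = Ss ->
    (forall (e : R) N, 0 < e -> exists2 k, (N <= k)%N & enorm (w k - x) < e) ->
    theta <= th -> gamma / q <= th -> th < 1 ->
  exists C2 C4, [/\ 0 <= C2, 0 <= C4, (fun k => enorm (w k - x)) @ \oo --> (0 : R),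
    \forall k \near \oo, enorm (w k - x) <=
      C2 * G k `^ (1 - th) + C4 * k%:R `^ (- (gamma + th * q - 1)) &
    \forall k \near \oo, `|S k - Ss| `^ th <= c * X k].
  move=> KLx xS freq thth gth th1.
  have [th01 th2 gth'] := th_ok th gth th1; have /andP[th0 _] := th01.
  have c0 : 0 <= c by case: KLx => _ /ltW.
  have [r r0 Hr] := KL_sequence cS KLx xS thth th0.
  have gq1 : 1 < gamma + th * q by move: gth'; rewrite -/q; lra.
  have [C2 [C4 [C20 C40 Z0 cZ HZ]]] :=
    KL_path lambda0 tau0 alo0 Cu0 step_bounds X0 p0 Gstep XG cG th01 th2 gq1 c0.
  have [||cD DZ] := @trapping R (fun k => enorm (w k - x)) p _ r r0 Z0 cZ _ _ freq
    (fun k => enorm_ge0 _).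
  - apply: nearW => k; apply: le_trans (ler_dist_enorm _ _) _.
    by rewrite opprB addrA subrK.
  - near=> k => Dk; have KLk : `|S k - Ss| `^ th <= c * X k by move: Dk; near: k.
    by move: KLk; near: k.
  exists C2, C4; split=> //.
  near=> k; have Dk : enorm (w k - x) < r by near: k; have /cvgr_lt := cD; exact.
  by move: Dk; near: k.
have [x cx] := cluster_exists.
have freq := cluster_frequently cx.
have [theta0 [c0 KL0]] := psi_KL x cx.
(* Membership of the cluster point in the domain is part of the KL property. *)
have dx : dom phi x.
  case: KL0 => _ _ + _.
  by rewrite /dom/= !ltey /psi /objective; apply: contra_neq => ->; rewrite addey.
have xS : favg f x + phr x = Ss by exact: cluster_value.
(* [gamma / q < 1] amounts to gamma > 1/2. *)
have th10 : Num.max theta0 (gamma / q) < 1.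
  case: KL0 => /andP[_ th01] _ _ _; rewrite gt_max th01/= ltr_pdivrMr// /q; lra.
have t1 : theta0 <= Num.max theta0 (gamma / q) by rewrite le_max lexx.
have t2 : gamma / q <= Num.max theta0 (gamma / q) by rewrite le_max lexx orbT.
have [_ [_ [_ _ cD _ _]]] := trap x theta0 c0 _ KL0 xS freq t1 t2 th10.
exists x; split.
- apply/cvgrPdist_lt => e e0; near=> k; rewrite distrC.
  apply: le_lt_trans (norm_le_enorm _) _.
  by near: k; have /cvgr_lt := cD; exact.
- exact: (limit_critical cS cX dx xS cD).
move=> theta c KLx gap err.
have c_ge0 : 0 <= c by case: KLx => _ /ltW.
have rates th r : theta <= th -> gamma / q <= th -> th < 1 -> 0 < r -> r <= q ->
    r * (2 * th - 1) = 1 - gamma \/ [/\ r = 2, th = 2^-1 & gamma = 1] ->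
    ((\forall k \near \oo, `|S k - Ss| `^ th <= c * X k) ->
      exists M, \forall k \near \oo, G k <= M * k%:R `^ (- r)) ->
    bigO_rate gap r /\ bigO_rate err (r * (1 - th)).
  move=> thth gth th1 r0 rq rE HM.
  have [th01 th2 gth'] := th_ok th gth th1.
  have [C2 [C4 [C20 C40 _ HD' HKL]]] := trap x theta c th KLx xS freq thth gth th1.
  have [M GM] := HM HKL.
  have rth : r * (1 - th) <= gamma + th * q - 1.
    have rthq : th * r <= th * q by rewrite ler_pM2l//; case/andP: th01.
    exact: path_exponent rthq rE.
  split; last first.
    have [M' HM'] := path_rate lambda0 tau0 XG th01 C20 C40 r0 rth GM.
    apply: (@bigO_rateI _ _ _ M'); near=> k; rewrite !lee_fin enorm_ge0/=.
    apply: (@le_trans _ _ (C2 * G k `^ (1 - th) + C4 * k%:R `^ (- (gamma + th * q - 1)))).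
      by near: k.
    by near: k.
  (* The first summand bounds the squared distance; M + Cu bounds the value gap, since r <= q gives
     u k <= Cu k^-r. *)
  apply: (@bigO_rateI _ _ _ (M / (tau * lambda / 4) + M + Cu)); near=> k.
  have k0 : (0 < k)%N by near: k; exact: near_lt0n.
  have k1 : 1 <= k%:R :> R by rewrite ler1n.
  have XGk : tau * lambda / 4 * X k ^+ 2 <= G k by near: k.
  have SGk : `|S k - Ss| <= G k + u k by near: k.
  have GMk : G k <= M * k%:R `^ (- r) by near: k.
  have Gk0 : 0 <= G k by near: k.
  have uk : u k <= Cu * k%:R `^ (- r) by rewrite ler_wpM2l// ler_powR// lerN2.
  have Xk : X k ^+ 2 <= M / (tau * lambda / 4) * k%:R `^ (- r).
    by rewrite mulrAC ler_pdivlMr// mulrC (le_trans XGk).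
  have Mk : 0 <= M * k%:R `^ (- r) by exact: le_trans GMk.
  have Cuk : 0 <= Cu * k%:R `^ (- r) by rewrite mulr_ge0 ?powR_ge0.
  have Xk0 : 0 <= M / (tau * lambda / 4) * k%:R `^ (- r) by exact: le_trans (sqr_ge0 _) Xk.
  have /andP[d0 dX] := dist0_subdiff k0.
  apply/andP; split; first by rewrite /gap le_max abse_ge0 orbT.
  rewrite /gap ge_max; apply/andP; split.
    apply: (@le_trans _ _ ((X k)%:E ^+ 2)%E).
      by rewrite !expe2 lee_pmul.
    rewrite -EFin_expe lee_fin (le_trans Xk)// mulrDl mulrDl -addrA lerDl.
    by rewrite addr_ge0.
  have SM : `|S k - Ss| <= (M / (tau * lambda / 4) + M + Cu) * k%:R `^ (- r).
    apply: (le_trans SGk); apply: (le_trans (lerD GMk uk)).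
    by rewrite !mulrDl -addrA lerDr.
  rewrite /psi (objective_fine f phi_proper dx) (objective_fine f phi_proper (iterate_dom k0)).
  by rewrite -/(phr x) xS -EFinB /= lee_fin.
split=> [gamma1 th thth gth th1|theta2 gE alpha16].
- have [th2 r0 rq rE] := superlinear_exponent (introT andP (conj g2 gamma1)) gth th1.
  apply: rates => //; first by left.
  move=> KL; exact: (KL_rate_superlinear lambda0 tau0 alo0 Cu0 step_bounds X0 Gstep XG cG
    th2 c_ge0 r0 rq rE KL).
have qE : q = 2 by rewrite /q gE; ring.
have gq2 : gamma / q <= 2^-1 by rewrite qE gE div1r.
have th12 : (2^-1 : R) < 1 by rewrite invf_lt1 ?ltr1n.
have r2q : 2 <= q by rewrite qE.
have r20 : (0 : R) < 2 by [].
rewrite -[X in bigO_rate err X](_ : 2 * (1 - 2^-1) = 1); last by field.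
apply: (rates _ _ theta2 gq2 th12 r20 r2q (or_intror _)) => //.
move=> KL.
set m := tau * lambda / 2 in alpha16.
have m0 : 0 < m by rewrite divr_gt0// (mulr_gt0 tau0 lambda0).
have cm0 : 0 < c ^+ 2 + m by rewrite ltr_wpDl// sqr_ge0.
have [Q Q2 HQ] := harmonic_domination cm0 alpha16 beta_ge0.
apply: (KL_rate_linear lambda0 tau0 alo0 step_bounds X0 Gstep XG gE Q2 c_ge0 _ KL).
apply: filterS HQ => k; rewrite -/m => HQ; apply: le_trans HQ _.
by rewrite /a /al gE powRr1 ?addr_ge0// invfM !mulrA [leRHS]mulrAC.
Unshelve. all: by end_near.
Qed.

End Iterates.


Theorem theorem24 (R : realType) (d n : nat) (d_gt0 : (0 < d)%N)
    (n_gt0 : (0 < n)%N)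
    (f : 'I_n -> 'rV[R]_d -> R) (phi : 'rV[R]_d -> \bar R)
    (L rho flb philb lambda alpha beta gamma : R)
    (pi : nat -> 'S_n) (z w : nat -> 'rV[R]_d)
    (f_diff : forall (i : 'I_n) (x : 'rV[R]_d), differentiable (f i) x)
    (L_gt0 : 0 < L)
    (f_lip : forall (i : 'I_n) (x y : 'rV[R]_d), dom phi x -> dom phi y ->
       enorm (grad (f i) x - grad (f i) y) <= L * enorm (x - y))
    (rho_gt0 : 0 < rho)
    (phi_wconvex : weakly_convex rho phi)
    (phi_lsc : lower_semicontinuous phi)
    (phi_proper : proper phi)
    (f_bound : forall (i : 'I_n) (x : 'rV[R]_d), dom phi x -> flb <= f i x)
    (phi_bound : forall x : 'rV[R]_d, dom phi x -> (philb%:E <= phi x)%E)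
    (lambda_range : 0 < lambda < (4 * rho)^-1)
    (alpha_gt0 : 0 < alpha) (beta_ge0 : 0 <= beta)
    (gamma_range : 2^-1 < gamma <= 1)
    (w_PRR : normPRR f phi lambda
       (fun k => alpha / ((beta + k%:R) `^ gamma)) pi z w)
    (w_bounded : bounded_fun w)
    (psi := objective f phi)
    (w_KL : forall x : 'rV[R]_d, cluster (w @ \oo) x -> KL_property psi x) :
  exists ws : 'rV[R]_d,
    [/\ w @ \oo --> ws,
        subdiff psi ws 0 &
        forall theta c : R, KL_with psi ws theta c ->
          let tau := tauPRR rho L lambda in
          let ct := c + Num.max 1 (tau * lambda / 2) in
          let gap := fun k : nat =>
            maxe (dist0 (subdiff psi (w k)) ^+ 2)%E `|psi (w k) - psi ws|%E in
          let err := fun k : nat => (enorm (w k - ws))%:E in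
          (gamma < 1 ->
             bigO_rate gap
               (if theta < gamma / (3 * gamma - 1) then 3 * gamma - 1
                else (1 - gamma) / (2 * theta - 1)) /\
             bigO_rate err
               (if theta < gamma / (3 * gamma - 1) then 2 * gamma - 1
                else (1 - theta) * (1 - gamma) / (2 * theta - 1))) /\
          (theta <= 2^-1 -> gamma = 1 -> 16 * ct ^+ 2 / (tau * n%:R) < alpha ->
             bigO_rate gap 2 /\ bigO_rate err 1)].
Proof.
have /andP[lambda0 lambda4] := lambda_range.
have lr : 4 * (lambda * rho) < 1.
  by rewrite mulrCA -ltr_pdivlMr ?mulr_gt0// div1r.
have /andP[g2 g1] := gamma_range.
have [ws [cw crit rates]] := normPRR_convergence n_gt0 f_diff L_gt0 f_lip rho_gt0
  phi_wconvex phi_lsc phi_proper f_bound phi_bound lambda0 lr alpha_gt0 beta_ge0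
  gamma_range w_PRR w_bounded w_KL.
exists ws; split=> // theta c KLws tau ct gap err.
have [theta01 c0 _ _] := KLws; have /andP[theta0 theta1] := theta01.
have q0 : 0 < 3 * gamma - 1 by lra.
have [superlinear linear] := rates theta c KLws.
split=> [gamma1|theta2 gE alpha16]; last first.
  apply: linear => //.
  have tau0 : 0 < tau by exact: tau_gt0.
  have tn0 : 0 < tau * n%:R by rewrite mulr_gt0// ltr0n.
  (* It remains to see c^2 + m <= (c + M)^2, which holds because M >= 1 gives m <= M <= M^2. *)
  move: alpha16; rewrite ltr_pdivrMr// [alpha * _]mulrC; apply: le_lt_trans.
  rewrite ler_pM2l// /ct -/tau; set m := tau * lambda / 2; set M := Num.max 1 m.
  have M1 : 1 <= M by rewrite le_max lexx.
  have mM : m <= M by rewrite le_max lexx orbT.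
  have : 0 <= c * M by rewrite mulr_ge0 ?(ltW c0)// (le_trans ler01).
  have : M <= M ^+ 2 by rewrite expr2 ler_peMr// (le_trans ler01).
  lra.
have gq1 : gamma / (3 * gamma - 1) < 1 by rewrite ltr_pdivrMr//; lra.
have [lt|ge] := ltP theta (gamma / (3 * gamma - 1)).
  (* Raise the exponent to the threshold: there the rate of the gap is 3 gamma - 1, and its product
     with 1 - th is 2 gamma - 1. *)
  have := superlinear gamma1 _ (ltW lt) (lexx _) gq1.
  have -> : (1 - gamma) / (2 * (gamma / (3 * gamma - 1)) - 1) = 3 * gamma - 1.
    have -> : 2 * (gamma / (3 * gamma - 1)) - 1 = (1 - gamma) / (3 * gamma - 1).
      by field; rewrite gt_eqF.
    by rewrite invf_div mulrC divfK// gt_eqF// subr_gt0.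
  have -> // : (3 * gamma - 1) * (1 - gamma / (3 * gamma - 1)) = 2 * gamma - 1.
  by field; rewrite gt_eqF.
have := superlinear gamma1 theta (lexx _) ge theta1.
by rewrite [_ * (1 - theta)]mulrC mulrA.
Qed.
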